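(* Fix $\lambda>0$ and consider $k\in\mathbb{N}$ depending on $N$ such that $k\sim\lambda N$ as $N\to\infty$. Then for all $p\in[2,+\infty]$ there exists $C>0$, depending only on $n$, $p$ and $\lambda$, such that, for $N$ large enough, for all $\nu\in\mathbb{N}^n$ with $|\nu|=k$, $$\|e_{\nu}\|_{L^p(\mathbb{C}^n)}\le C\,N^{\left(n-\frac12\right)\left(\frac12-\frac1p\right)}.$$ Furthermore, this bound is sharp, since the inequality becomes an equivalence when $\nu$ is replaced by $\mu=(k,0,\dots,0)\in\mathbb{N}^n$: there is a constant $C'>0$ depending only on $n$, $p$, $\lambda$ such that $\|e_{\mu}\|_{L^p(\mathbb{C}^n)}\sim C'N^{\left(n-\frac12\right)\left(\frac12-\frac1p\right)}$ as $N\to\infty$.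
   Context: For $N\in\mathbb{N}\setminus\{0\}$ and $\alpha\in\mathbb{N}^n$, $$e_{\alpha}(z)=\frac{N^{\frac{n+|\alpha|}{2}}e^{-\frac{N|z|^2}{2}}z^{\alpha}}{\pi^{\frac n2}\sqrt{\alpha!}},\qquad z\in\mathbb{C}^n,$$ where $|\alpha|=\sum_j\alpha_j$, $\alpha!=\prod_j\alpha_j!$, $z^\alpha=\prod_j z_j^{\alpha_j}$. These functions depend on $N$ and form a Hilbert basis of the Bargmann space $L^2(\mathbb{C}^n)\cap\{e^{-N|z|^2/2}g: g\text{ holomorphic}\}$. $L^p(\mathbb{C}^n)$ is with respect to Lebesgue measure; $1/p=0$ for $p=\infty$; $A_N\sim B_N$ means $A_N/B_N\to1$. *)

(* Defs.v *)
From HB Require Import structures.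
From mathcomp Require Import all_boot all_order all_algebra.
From mathcomp Require Import complex.
From mathcomp Require Import all_classical all_reals all_analysis.

Set Implicit Arguments.
Unset Strict Implicit.
Unset Printing Implicit Defensive.

Import Order.TTheory GRing.Theory Num.Theory.
Import numFieldNormedType.Exports.

Local Open Scope classical_set_scope.
Local Open Scope ring_scope.

(* The product measure \x has a canonical measure structure but its
   sigma-finiteness cannot be inferred: the canonical instance is shadowed by
   the one for products of subprobabilities. *)
Section product_sigma_finite.
Context {d1 d2} {T1 : measurableType d1} {T2 : measurableType d2} {R : realType}.
Variables (m1 : {sigma_finite_measure set T1 -> \bar R})
          (m2 : {sigma_finite_measure set T2 -> \bar R}).

Definition product_measure_sf : set (T1 * T2) -> \bar R := (m1 \x m2)%E.

HB.instance Definition _ := Measure.copy product_measure_sf (m1 \x m2)%E.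

Let product_measure_sf_sigma_finite : sigma_finite [set: T1 * T2] product_measure_sf.
Proof.
have /sigma_finiteP[F [TF ndF Foo]] := sigma_finiteT m1.
have /sigma_finiteP[G [TG ndG Goo]] := sigma_finiteT m2.
exists (fun n => F n `*` G n).
  rewrite -setXTT TF TG predeqE => -[x y]; split.
    move=> [/= [n _ Fnx] [k _ Gky]]; exists (maxn n k) => //; split.
    - by move: x Fnx; exact/subsetPset/ndF/leq_maxl.
    - by move: y Gky; exact/subsetPset/ndG/leq_maxr.
  by move=> [n _ []/= ? ?]; split; exists n.
move=> k; have [? ?] := Foo k; have [? ?] := Goo k.
split; first exact: measurableX.
rewrite /product_measure_sf product_measure1E//.
by rewrite lte_mul_pinfty// ge0_fin_numE.
Qed.

HB.instance Definition _ := Measure_isSigmaFinite.Build _ _ _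
  product_measure_sf product_measure_sf_sigma_finite.
End product_sigma_finite.

(* The image of a sigma-finite measure by a measurable map with a measurable
   left inverse is again sigma-finite; the three proofs are parameters so that
   the measure structure can be inferred. *)
Section image_measure.
Context {d d'} {T : measurableType d} {T' : measurableType d'} {R : realType}.
Variables (m : {sigma_finite_measure set T -> \bar R}).
Variables (f : T -> T') (g : T' -> T).
Hypotheses (mf : measurable_fun [set: T] f) (mg : measurable_fun [set: T'] g).
Hypothesis fK : cancel f g.

Definition image_measure of measurable_fun [set: T] f
    & measurable_fun [set: T'] g & cancel f g : set T' -> \bar R :=
  pushforward m f.

Local Notation mu := (image_measure mf mg fK).

Let mu0 : mu set0 = 0%E.
Proof. by rewrite /image_measure /pushforward preimage_set0 measure0. Qed.

Let mu_ge0 A : (0 <= mu A)%E.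
Proof. exact: measure_ge0. Qed.

Let mu_sigma_additive : semi_sigma_additive mu.
Proof.
exact: (@measure_semi_sigma_additive _ _ _ (pushforward m f : {measure set T' -> \bar R})).
Qed.

HB.instance Definition _ :=
  isMeasure.Build _ _ _ mu mu0 mu_ge0 mu_sigma_additive.

Let mu_sigma_finite : sigma_finite [set: T'] mu.
Proof.
have [F TF mF] := sigma_finiteT m.
exists (fun i => g @^-1` F i); first by rewrite -preimage_bigcup -TF preimage_setT.
move=> i; have [mFi Fi] := mF i; split.
  by rewrite -[X in measurable X]setTI; exact: mg.
rewrite /image_measure /pushforward -comp_preimage.
by rewrite (_ : g \o f = id)//; apply/funext.
Qed.

HB.instance Definition _ :=
  Measure_isSigmaFinite.Build _ _ _ mu mu_sigma_finite.
End image_measure.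

(* R[i] carries the sigma-algebra transported from R * R by
   z |-> (Re z, Im z), i.e. the Borel sigma-algebra of the plane. *)
Section measurable_complex.
Context {R : realType}.
Local Open Scope complex_scope.

Definition complex_to_pair (z : R[i]) : measurableTypeR R * measurableTypeR R :=
  (complex.Re z, complex.Im z).

Definition pair_to_complex (x : measurableTypeR R * measurableTypeR R) : R[i] :=
  x.1 +i* x.2.


HB.instance Definition _ := isPointed.Build R[i] 0.

Let cmeas := preimage_set_system [set: R[i]] complex_to_pair measurable.

Let cmeas_sigma_algebra : sigma_algebra [set: R[i]] cmeas.
Proof. exact/sigma_algebra_preimage/sigma_algebra_measurable. Qed.

Let cmeas0 : cmeas set0.
Proof. by have [] := cmeas_sigma_algebra. Qed.

Let cmeasC A : cmeas A -> cmeas (~` A).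
Proof. by have [_ + _] := cmeas_sigma_algebra => /[apply]; rewrite setTD. Qed.

Let cmeas_bigcup (F : (set R[i])^nat) :
  (forall i, cmeas (F i)) -> cmeas (\bigcup_i F i).
Proof. by have [_ _] := cmeas_sigma_algebra; exact. Qed.

HB.instance Definition _ := @isMeasurable.Build default_measure_display
  R[i] cmeas cmeas0 cmeasC cmeas_bigcup.
End measurable_complex.

Section lebesgue_complex.
Context {R : realType}.

Lemma measurable_complex_to_pair :
  measurable_fun [set: R[i]] (@complex_to_pair R).
Proof. by move=> _ B mB; rewrite setTI; exists B => //; rewrite setTI. Qed.

Lemma measurable_pair_to_complex :
  measurable_fun [set: measurableTypeR R * measurableTypeR R] pair_to_complex.
Proof.
move=> _ _ [B mB <-]; rewrite !setTI -comp_preimage.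
by rewrite (_ : _ \o _ = id)//; apply/funext => -[].
Qed.

Lemma pair_to_complexK : cancel (@pair_to_complex R) complex_to_pair.
Proof. by case. Qed.

(* Area measure dx dy, for z = x + iy. *)
Definition lebesgue_C : {sigma_finite_measure set R[i] -> \bar R} :=
  image_measure (product_measure_sf lebesgue_measure lebesgue_measure)
    measurable_pair_to_complex measurable_complex_to_pair pair_to_complexK.

Definition cons_tuple n (u : R[i] * n.-tuple R[i]) : n.+1.-tuple R[i] :=
  [tuple of u.1 :: u.2].

Definition uncons_tuple n (z : n.+1.-tuple R[i]) : R[i] * n.-tuple R[i] :=
  (thead z, [tuple of behead z]).

Lemma measurable_cons_tuple n :
  measurable_fun [set: R[i] * n.-tuple R[i]] (@cons_tuple n).
Proof. exact: measurable_cons. Qed.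

Lemma measurable_uncons_tuple n :
  measurable_fun [set: n.+1.-tuple R[i]] (@uncons_tuple n).
Proof.
by apply: measurable_fun_pair; [exact: measurable_tnth|exact: measurable_behead].
Qed.

Lemma cons_tupleK n : cancel (@cons_tuple n) (@uncons_tuple n).
Proof. by move=> [z x]; rewrite /uncons_tuple/= theadE; congr pair; exact/val_inj. Qed.

(* C^n is n.-tuple R[i] with its product sigma-algebra; C^0 is a point of
   mass 1, and C^n.+1 is identified with C * C^n. *)
Fixpoint lebesgue_Cn n : {sigma_finite_measure set (n.-tuple R[i]) -> \bar R} :=
  match n with
  | 0 => dirac [tuple]
  | m.+1 => image_measure (product_measure_sf lebesgue_C (lebesgue_Cn m))
              (@measurable_cons_tuple m) (@measurable_uncons_tuple m)
              (@cons_tupleK m)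
  end.

End lebesgue_complex.

Section bargmann_basis.
Context {R : realType}.
Local Open Scope complex_scope.

Definition multiabs n (alpha : n.-tuple nat) : nat :=
  (\sum_(j < n) tnth alpha j)%N.

Definition multifact n (alpha : n.-tuple nat) : nat :=
  (\prod_(j < n) (tnth alpha j)`!)%N.

Definition multipow n (z : n.-tuple R[i]) (alpha : n.-tuple nat) : R[i] :=
  \prod_(j < n) tnth z j ^+ tnth alpha j.

Definition sqr_norm n (z : n.-tuple R[i]) : R :=
  \sum_(j < n) ComplexField.Normc.normc (tnth z j) ^+ 2.

Definition bargmann_e (N n : nat) (alpha : n.-tuple nat) (z : n.-tuple R[i])
    : R[i] :=
  (N%:R `^ ((n + multiabs alpha)%:R / 2) * expR (- (N%:R * sqr_norm z / 2)))%:C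
    * multipow z alpha
  / (pi `^ (n%:R / 2) * Num.sqrt (multifact alpha)%:R)%:C.

Definition Lp_norm n (p : \bar R) (f : n.-tuple R[i] -> R[i]) : \bar R :=
  ('N[lebesgue_Cn n]_p [ (fun z => (ComplexField.Normc.normc (f z))%:E) ])%E.

(* Stated in \bar R so that A ~ B forces A to be eventually finite; a zero
   denominator gives +oo and matters only if it recurs for arbitrarily large N. *)
Definition asymp_equiv (A B : nat -> \bar R) : Prop :=
  (A N / B N)%E @[N --> \oo] --> 1%E.

End bargmann_basis.

(* Main.v *)
Require Import Defs.
From mathcomp Require Import all_boot all_order all_algebra.
From mathcomp Require Import complex.
From mathcomp Require Import all_classical all_reals all_analysis.
From mathcomp Require Import measurable_realfun ess_sup_inf.
From mathcomp Require Import ring lra.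
Set Implicit Arguments.
Unset Strict Implicit.
Import Order.TTheory GRing.Theory Num.Theory.
Import numFieldNormedType.Exports.
Local Open Scope classical_set_scope.
Local Open Scope ring_scope.


(* In modulus e_nu is the tensor product of the one-variable functions e_{nu_j},
   so by Tonelli its L^p norm is the product of theirs.  In one variable |e_m|
   depends on t = N |z|^2 only, and t is distributed as a multiple of Lebesgue
   measure on the half line, hence ||e_m||_p = N^d c_p(m) with d = 1/2 - 1/p.
   Put t = m + s sqrt m: t^m e^(-t) is then m^m e^(-m) times a function of s
   converging to exp(-s^2/2) and dominated by a multiple of exp(-|s|/2), so
   Laplace's method and Stirling's formula (with unspecified constants) give
   c_p(m) ~ c m^(-d/2).  As prod_j (1 + nu_j) >= 1 + |nu|, the product of the
   c_p(nu_j) is O(|nu|^(-d/2)), and for nu = (k,0,...,0) only one factor decays. *)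

(** * Area in polar coordinates *)

(** The constants C and C' only have to exist and be positive, so each asymptotic constant comes
    from a soft argument: the area of the disc from scaling, the Stirling constant from a monotone
    bounded sequence, the Laplace limit from dominated convergence. The upper bound must be uniform
    in nu, whose components may be small or zero even when |nu| is large. The one-variable
    equivalence suffices for this: a convergent sequence is bounded, so each factor is at most K (1
    + nu_j)^(-d/2) for every value of nu_j. The hypothesis p >= 2 gives d >= 0, so that raising to
    the power d/2 preserves the inequality 1 + |nu| <= prod_j (1 + nu_j) and the lower bound |nu| >=
    lambda N / 2. The exponent of N is then n d from the scaling of the n factors, minus d/2 from
    the decay in |nu|. *)

Section affine_change_of_variable.
Context (R : realType).
Local Open Scope ereal_scope.
Local Notation mu := (@lebesgue_measure R).

Lemma measurable_affine (a b : R) :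
  measurable_fun [set: measurableTypeR R]
    (fun x : measurableTypeR R => (a * x + b)%R : measurableTypeR R).
Proof. by apply: measurable_funD => //; exact: measurable_funM. Qed.

(** The image of Lebesgue measure under the affine map, multiplied by a, gives every interval ]x, y]
    its length, so it is Lebesgue measure by uniqueness. *)
Lemma ge0_integral_affine (a b : R) (F : R -> \bar R) : (0 < a)%R ->
  measurable_fun [set: R] F -> (forall x, 0 <= F x) ->
  \int[mu]_x F (a * x + b)%R = a^-1%:E * \int[mu]_x F x.
Proof.
move=> a0 mF F0.
pose phi (x : measurableTypeR R) : measurableTypeR R := (a * x + b)%R.
have mphi : measurable_fun setT phi := measurable_affine a b.
pose ann := NngNum (ltW a0).
have muE A : measurable A -> mu A = mscale ann (pushforward mu phi) A.
  move=> mA; apply: lebesgue_measure_unique => // _ [[x y]] _ <-.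
  rewrite /= /pushforward /mscale.
  rewrite [X in _ * mu X](_ : _ = `]((x - b) / a)%R, ((y - b) / a)%R]%classic);
    last first.
    apply/seteqP; split => z; rewrite /= !in_itv/= /phi;
    by rewrite ltr_pdivrMr// ler_pdivlMr// ltrBlDr lerBrDr (mulrC z).
  rewrite !lebesgue_measure_itv/= !lte_fin ltr_pM2r ?invr_gt0// ltrD2r.
  case: ifPn => xy; last by rewrite mule0.
  by rewrite -EFinD -EFinM; congr (_%:E); field; rewrite gt_eqF.
transitivity (\int[pushforward mu phi]_x F x).
  by rewrite ge0_integral_pushforward.
rewrite [X in _ = _ * X](eq_measure_integral (mscale ann (pushforward mu phi))).
  rewrite ge0_integral_mscale//= muleA -EFinM mulVf ?mul1e// gt_eqF//.
by move=> A mA _; exact: muE.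
Qed.

End affine_change_of_variable.

Section squared_modulus.
Context (R : realType).
Local Open Scope ereal_scope.
Local Notation mu := (@lebesgue_measure R).

Definition sqrmod (z : R[i]) : R := (complex.Re z ^+ 2 + complex.Im z ^+ 2)%R.

Lemma sqrmod_ge0 z : (0 <= sqrmod z)%R.
Proof. by rewrite addr_ge0 ?sqr_ge0. Qed.

Lemma measurable_sqrmod :
  measurable_fun [set: R[i]] (sqrmod : _ -> measurableTypeR R).
Proof.
have mC := @measurable_complex_to_pair R.
apply: measurable_funD; apply: measurable_funX.
- exact: (measurableT_comp measurable_fst mC).
- exact: (measurableT_comp measurable_snd mC).
Qed.

(** Each vertical chord has half-length sqrt(t - x^2). Off the disc [Num.sqrt] of a negative number
    is 0, which matches the empty chord, so the integral may run over the whole line and t may have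
    any sign. *)
Lemma lebesgue_C_disc_integral (t : R) :
  lebesgue_C (sqrmod @^-1` `]-oo, t[) =
  \int[mu]_x (2 * Num.sqrt (t - x ^+ 2))%:E.
Proof.
rewrite /= /image_measure /pushforward/= /product_measure_sf/= /product_measure1.
apply: eq_integral => x _ /=.
rewrite [X in mu X](_ : _ =
   `](- Num.sqrt (t - x ^+ 2))%R, (Num.sqrt (t - x ^+ 2))%R[%classic); last first.
  apply/seteqP; split => y; rewrite /xsection/= inE/= /sqrmod/= !in_itv/=.
    move=> xyt; have t0 : (0 <= t - x ^+ 2)%R.
      by rewrite subr_ge0 (le_trans _ (ltW xyt))// lerDl sqr_ge0.
    rewrite -ltr_norml -ltr_sqr ?nnegrE ?sqrtr_ge0//.
    by rewrite sqr_sqrtr// real_normK ?num_real// ltrBrDl.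
  rewrite -ltr_norml.
  have [t0|t0] := leP 0%R (t - x ^+ 2)%R.
    rewrite -ltr_sqr ?nnegrE ?sqrtr_ge0//.
    by rewrite sqr_sqrtr// real_normK ?num_real// ltrBrDl.
  by rewrite (ltr0_sqrtr t0) ltNge normr_ge0.
rewrite lebesgue_measure_itv/= lte_fin.
case: ifPn => [_|]; first by rewrite -EFinD; congr (_%:E); ring.
rewrite -leNgt => h.
have s0 := sqrtr_ge0 (t - x ^+ 2).
have -> : Num.sqrt (t - x ^+ 2) = 0%R by lra.
by rewrite mulr0.
Qed.

End squared_modulus.

Section disc_area.
Context (R : realType).
Local Open Scope ereal_scope.
Local Notation mu := (@lebesgue_measure R).
Local Notation sqrmod := (@sqrmod R).

Lemma measurable_disc (t : R) : measurable (sqrmod @^-1` `]-oo, t[).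
Proof. by rewrite -[X in measurable X]setTI; exact: (measurable_sqrmod (R := R)). Qed.

(** The unit disc contains the square of half-side 1/2 and lies in the one of half-side 1;
    comparison with them shows that [disc_area] is positive and finite. *)
Lemma lebesgue_C_square (a : R) : (0 < a)%R ->
  lebesgue_C [set z : R[i] | - a < complex.Re z < a /\ - a < complex.Im z < a]%R =
  (4 * a ^+ 2)%:E.
Proof.
move=> a0; rewrite /= /image_measure /pushforward/= /product_measure_sf/=.
rewrite (_ : _ @^-1` _ = `](- a)%R, a[%classic `*` `](- a)%R, a[%classic); last first.
  by apply/seteqP; split => -[x y]; rewrite /= !in_itv/=.
rewrite product_measure1E//= !lebesgue_measure_itv/= !lte_fin gtrN//.
by rewrite -!EFinD -EFinM; congr (_%:E); ring.
Qed.

Lemma measurable_square (a : R) :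
  measurable [set z : R[i] | - a < complex.Re z < a /\ - a < complex.Im z < a]%R.
Proof.
exists (`](- a)%R, a[%classic `*` `](- a)%R, a[%classic); first exact: measurableX.
by rewrite setTI; apply/seteqP; split => -[x y]; rewrite /= !in_itv/=.
Qed.

Definition disc_area : R := fine (lebesgue_C (sqrmod @^-1` `]-oo, 1%R[)).

Lemma disc1_fin_num : lebesgue_C (sqrmod @^-1` `]-oo, 1%R[) \is a fin_num.
Proof.
rewrite ge0_fin_numE ?measure_ge0//.
apply: (@le_lt_trans _ _ (4 * 1 ^+ 2)%:E); last by rewrite ltry.
rewrite -lebesgue_C_square//; apply: le_measure; rewrite ?inE;
  [exact: measurable_disc|exact: measurable_square|].
move=> z; rewrite /= in_itv/= /sqrmod => z1; have := sqr_ge0 (complex.Re z).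
by have := sqr_ge0 (complex.Im z) => h1 h2; split; nra.
Qed.

Lemma disc_area_gt0 : (0 < disc_area)%R.
Proof.
rewrite /disc_area -lte_fin fineK; last exact: disc1_fin_num.
apply: (@lt_le_trans _ _ (4 * 2^-1 ^+ 2)%:E); first by rewrite lte_fin; lra.
rewrite -lebesgue_C_square ?invr_gt0//; apply: le_measure; rewrite ?inE;
  [exact: measurable_square|exact: measurable_disc|].
by move=> z; rewrite /= in_itv/= /sqrmod => -[/andP[? ?] /andP[? ?]]; nra.
Qed.

(* The integral formula scales like t under x = u sqrt t.  The value of
   [disc_area], which is pi, is never needed. *)
Lemma lebesgue_C_disc (t : R) : (0 <= t)%R ->
  lebesgue_C (sqrmod @^-1` `]-oo, t[) = (disc_area * t)%:E.
Proof.
rewrite le_eqVlt => /predU1P[<-|t0].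
  rewrite mulr0 (_ : _ @^-1` _ = set0) ?measure0//.
  by apply/seteqP; split => z //=; rewrite in_itv/= ltNge sqrmod_ge0.
rewrite EFinM fineK; last exact: disc1_fin_num.
have st0 : (0 < Num.sqrt t)%R by rewrite sqrtr_gt0.
have st0' : (Num.sqrt t != 0)%R by rewrite gt_eqF.
have F0 x : (0 <= 2 * Num.sqrt (1 - x ^+ 2) :> R)%R by rewrite mulr_ge0 ?sqrtr_ge0.
have mF : measurable_fun [set: R] (fun x => 2 * Num.sqrt (1 - x ^+ 2) : R)%R.
  apply: measurable_funM => //; apply: (measurableT_comp (continuous_measurable_fun _)).
    exact: sqrt_continuous.
  by apply: measurable_funB => //; exact: measurable_funX.
rewrite !lebesgue_C_disc_integral.
transitivity (\int[mu]_x ((Num.sqrt t)%:E *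
    (2 * Num.sqrt (1 - ((Num.sqrt t)^-1 * x + 0) ^+ 2))%:E)).
  apply: eq_integral => x _; rewrite -EFinM; congr (_%:E).
  rewrite mulrCA; congr (2 * _)%R; rewrite addr0 -sqrtrM ?ltW//; congr Num.sqrt.
  by rewrite mulrBr mulr1 exprMn exprVn sqr_sqrtr ?ltW// mulVKf// gt_eqF.
rewrite ge0_integralZl//; last first.
- apply/measurable_EFinP.
  exact: (measurableT_comp mF (measurable_affine (Num.sqrt t)^-1 0)).
rewrite (ge0_integral_affine 0 (F := fun x => (2 * Num.sqrt (1 - x ^+ 2))%:E))//.
- rewrite muleA invrK -EFinM -expr2 sqr_sqrtr ?ltW// muleC//.
- by rewrite invr_gt0.
- exact/measurable_EFinP.
Qed.

End disc_area.

Section radial_integration.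
Context (R : realType).
Local Open Scope ereal_scope.
Local Notation mu := (@lebesgue_measure R).
Local Notation sqrmod := (@sqrmod R).

(** The area of a disc is linear in its squared radius, so both sides agree on the rays ]-oo, x[.
    These are stable under intersection, generate the Borel sets and exhaust the line with finite
    mass, hence the two measures coincide. *)
Lemma lebesgue_C_sqrmod (A : set (measurableTypeR R)) : measurable A ->
  lebesgue_C (sqrmod @^-1` A) = (disc_area R)%:E * mu (A `&` `[0%R, +oo[).
Proof.
pose phi (x : R[i]) : measurableTypeR R := sqrmod x.
have mphi : measurable_fun setT phi := @measurable_sqrmod R.
have mD : measurable (`[0%R, +oo[%classic : set (measurableTypeR R)).
  exact: measurable_itv.
pose ann := NngNum (ltW (disc_area_gt0 R)).
move=> mA.
rewrite -[LHS]/(pushforward lebesgue_C phi A) -[RHS]/(mscale ann (mrestr mu mD) A).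
refine (@measure_unique _ R (measurableTypeR R) (@RGenInftyO.G R)
  (fun k => `]-oo, k%:R[%classic)
  _ _ _ _ (pushforward lebesgue_C phi) (mscale ann (mrestr mu mD)) _ _ A mA) => //.
- exact: RGenInftyO.measurableE.
- move=> _ _ [x ->] [y ->]; exists (Order.min x y).
  by apply/seteqP; split => z; rewrite /= !in_itv/= lt_min => /andP.
- by move=> k; exists k%:R.
- apply/seteqP; split => // x _; exists (Num.truncn x).+1 => //=.
  by rewrite in_itv/= truncnS_gt.
- move=> _ [x ->]; rewrite -[LHS]/(lebesgue_C (sqrmod @^-1` `]-oo, x[)).
  rewrite -[RHS]/((disc_area R)%:E * mu (`]-oo, x[%classic `&` `[0%R, +oo[%classic)).
  have [x0|x0] := leP 0%R x.
    rewrite lebesgue_C_disc// (_ : _ `&` _ = `[0%R, x[%classic); last first.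
      by apply/seteqP; split => z; rewrite /= !in_itv/= andbT;
        [case=> -> -> | case/andP=> -> ->].
    rewrite lebesgue_measure_itv/= lte_fin EFinM.
    case: ltP => x0'; first by rewrite oppr0 adde0.
    by rewrite (_ : x = 0%R)//; apply/eqP; rewrite eq_le x0 x0'.
  rewrite (_ : _ @^-1` _ = set0); last first.
    apply/seteqP; split => z //=; rewrite in_itv/= ltNge => /negP; apply.
    by rewrite (le_trans (ltW x0))// sqrmod_ge0.
  rewrite (_ : _ `&` _ = set0) ?measure0 ?mule0//.
  apply/seteqP; split => z //=; rewrite !in_itv/= andbT => -[zx z0].
  by have := lt_trans (le_lt_trans z0 zx) x0; rewrite ltxx.
- move=> k; rewrite -[X in X < _]/(lebesgue_C (sqrmod @^-1` `]-oo, k%:R[)).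
  by rewrite lebesgue_C_disc// ltry.
Unshelve. exact: mphi.
Qed.

Lemma ge0_integral_radial (F : R -> \bar R) :
  measurable_fun [set: R] F -> (forall x, 0 <= F x) ->
  \int[lebesgue_C]_z F (sqrmod z) =
  (disc_area R)%:E * \int[mu]_(t in `[0%R, +oo[) F t.
Proof.
move=> mF F0.
pose phi (x : R[i]) : measurableTypeR R := sqrmod x.
have mphi : measurable_fun setT phi := @measurable_sqrmod R.
have mD : measurable (`[0%R, +oo[%classic : set (measurableTypeR R)).
  exact: measurable_itv.
pose ann := NngNum (ltW (disc_area_gt0 R)).
transitivity (\int[pushforward lebesgue_C phi]_x F x).
  by rewrite [RHS]ge0_integral_pushforward.
rewrite (eq_measure_integral (mscale ann (mrestr mu mD))); last first.
  by move=> A mA _; exact: lebesgue_C_sqrmod.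
rewrite ge0_integral_mscale//; congr (_ * _).
(* The restricted measure gives no mass to the negative half line and agrees with [mu] on subsets of
   [[0, +oo[]. *)
rewrite (ge0_negligible_integral
  (N := (~` (`[0%R, +oo[%classic : set (measurableTypeR R)))%classic))//;
  last 2 first.
- exact: measurableC.
- by rewrite -[LHS]/(mu (~` `[0%R, +oo[%classic `&` `[0%R, +oo[%classic)) setICl measure0.
rewrite setDE setCK setTI; apply: eq_measure_integral => A mA AD.
by rewrite -[LHS]/(mu (A `&` `[0%R, +oo[%classic)); congr (mu _); exact/setIidl.
Qed.

Lemma ge0_integral_radial_affine (a b : R) (F : R -> \bar R) : (0 < a)%R ->
  measurable_fun [set: R] F -> (forall x, 0 <= F x) ->
  \int[lebesgue_C]_z F (a * sqrmod z - b)%R =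
  (disc_area R / a)%:E * \int[mu]_(t in `[(- b)%R, +oo[) F t.
Proof.
move=> a0 mF F0.
rewrite (ge0_integral_radial (F := fun t => F (a * t - b)%R))//; last first.
  exact: (measurableT_comp mF (measurable_affine a (- b))).
rewrite integral_mkcond EFinM -muleA; congr (_ * _).
rewrite [in RHS]integral_mkcond.
rewrite -(ge0_integral_affine (- b))//; last 2 first.
- by apply/(measurable_restrict _ _ _); rewrite ?setTI//; exact: measurable_funTS.
- by move=> x; rewrite erestrict_ge0.
apply: eq_integral => x _; rewrite !patchE.
by rewrite !mem_setE !in_itv/= !andbT lerDr pmulr_rge0.
Qed.

End radial_integration.

(** * Stirling and Laplace asymptotics *)

Section log_estimates.
Context (R : realType).
Implicit Types (a b u v x y : R) (f df : R -> R).

Lemma is_derive_ge0_le f df a b : a <= b ->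
  (forall x, a <= x <= b -> is_derive x 1 f (df x)) ->
  (forall x, a <= x <= b -> 0 <= df x) -> f a <= f b.
Proof.
rewrite le_eqVlt => /predU1P[->//|ab] fdf df0.
have [||c cab fab] := @MVT R f df a b ab.
- by move=> x; rewrite in_itv/= => /andP[ax xb]; apply: fdf; rewrite !ltW.
- apply: derivable_within_continuous => x; rewrite in_itv/= => axb.
  by have [] := fdf x axb.
- rewrite -subr_ge0 fab mulr_ge0//; last by rewrite subr_ge0 ltW.
  by apply: df0; move: cab; rewrite in_itv/= => /andP[? ?]; rewrite !ltW.
Qed.

(* [ln] minus its second Taylor polynomial at 1 has derivative (u - 1)^2 / u. *)
Let f1 : R -> R := @ln R - (id - 2^-1 \*: ((id - cst 1) ^+ 2)).

Let f1_le a b : 0 < a -> a <= b -> f1 a <= f1 b.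
Proof.
move=> a0 ab; apply: (@is_derive_ge0_le f1 (fun x => (x - 1) ^+ 2 / x)) => // x /andP[ax xb];
  have x0 := lt_le_trans a0 ax.
  have h := is_derive1_ln x0.
  rewrite /f1; apply: is_derive_eq; rewrite /GRing.scale/=.
  rewrite (_ : (id - cst 1 : R -> R) x = x - 1)//.
  by field; rewrite gt_eqF.
by rewrite divr_ge0 ?sqr_ge0// ltW.
Qed.

Let f1E u : f1 u = ln u - (u - (u - 1) ^+ 2 / 2).
Proof. by rewrite /f1/= (mulrC (_ ^+ 2)). Qed.

Lemma ln_taylor2_ge u : 1 <= u -> (u - 1) - (u - 1) ^+ 2 / 2 <= ln u.
Proof. by move=> u1; have := f1_le ltr01 u1; rewrite !f1E ln1; lra. Qed.

Lemma ln_taylor2_le u : 0 < u <= 1 -> ln u <= (u - 1) - (u - 1) ^+ 2 / 2.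
Proof. by move=> /andP[u0 u1]; have := f1_le u0 u1; rewrite !f1E ln1; lra. Qed.

Lemma sinh_ge y : 0 <= y -> y *+ 2 <= expR y - expR (- y).
Proof.
move=> y0; pose f : R -> R := @expR R - ((@expR R \o -%R) + (2 \*: id)).
have : f 0 <= f y.
  apply: (@is_derive_ge0_le f (fun x => (expR (x / 2) - expR (- (x / 2))) ^+ 2)) => //.
    move=> x _; rewrite /f; apply: is_derive_eq; rewrite /GRing.scale/=.
    rewrite sqrrB -!expRM_natl -expRD subrr expR0.
    have -> : 2%:R * (x / 2) = x by field.
    have -> : 2%:R * (- (x / 2)) = - x by field.
    by ring.
  by move=> x _; exact: sqr_ge0.
have fE z : f z = expR z - (expR (- z) + 2 * z) by [].
by rewrite !fE oppr0 expR0; lra.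
Qed.

(** This is [sinh_ge] at y = ln u. For u = 1 + v it reads ln(1 + v) - v <= - v^2 / (2 (1 + v)), the
    form that controls the right tail of the weight. *)
Lemma ln_le_sinh u : 1 <= u -> ln u <= (u - u^-1) / 2.
Proof.
move=> u1; have u0 : 0 < u by lra.
have := sinh_ge (ln_ge0 u1); rewrite expRN lnK ?posrE//; lra.
Qed.

Lemma ln_ge_sinh u : 0 < u <= 1 -> (u - u^-1) / 2 <= ln u.
Proof.
move=> /andP[u0 u1]; have : 1 <= u^-1 by rewrite invr_ge1 ?unitf_gt0// gt_eqF.
by move=> /ln_le_sinh; rewrite lnV ?posrE// invrK; lra.
Qed.

(** At u = 1 + 1/m the left side equals 1 / (m + 1/2), the exact inverse of the factor in front of
    the logarithm in [logfactB]; this is what makes [logfact] nonincreasing. *)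
Lemma ln_ge_pade u : 1 <= u -> 2 * (u - 1) / (u + 1) <= ln u.
Proof.
move=> u1; have u0 : 0 < u by lra.
rewrite ler_pdivrMr; last by lra.
pose f : R -> R := id * @expR R + id - 2 \*: @expR R.
have : f 0 <= f (ln u).
  apply: (@is_derive_ge0_le f (fun x => expR x * (x - 1 + expR (- x)))).
  - exact: ln_ge0.
  - move=> x _; rewrite /f; apply: is_derive_eq; rewrite /GRing.scale/=.
    by rewrite mulrDr -expRD subrr expR0; ring.
  - move=> x _; rewrite mulr_ge0 ?expR_ge0//.
    by have := expR_ge1Dx (- x); lra.
have fE z : f z = z * expR z + z - 2 * expR z by [].
by rewrite !fE expR0 lnK ?posrE//; lra.
Qed.

End log_estimates.

(** * Stirling's formula and the weight rescaled around its peak *)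

Section stirling.
Context (R : realType).
Implicit Types (q s t : R) (m : nat).

Definition weight m t : R := t ^+ m * expR (- t).

(* The index is shifted to avoid [ln 0]. *)
Let logfact m : R :=
  ln m.+1`!%:R + m.+1%:R - (m.+1%:R + 2^-1) * ln m.+1%:R.

Let expR_logfact m :
  expR (logfact m) = m.+1`!%:R / (weight m.+1 m.+1%:R * Num.sqrt m.+1%:R).
Proof.
have m0 : 0 < m.+1%:R :> R by [].
rewrite /logfact expRB expRD lnK ?posrE ?ltr0n ?fact_gt0//.
rewrite (mulrC (_ + _)) expRM lnK ?posrE// powRD ?gt_eqF ?implybT//.
rewrite powR_mulrn// powR12_sqrt// /weight expRN.
have m1 := expR_gt0 (m.+1%:R : R).
have m2 : 0 < Num.sqrt m.+1%:R :> R by rewrite sqrtr_gt0.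
have m3 : 0 < m.+1%:R ^+ m.+1 :> R by rewrite exprn_gt0.
by field; rewrite !gt_eqF.
Qed.

Let logfactB m : logfact m - logfact m.+1 =
  (m.+1%:R + 2^-1) * ln (1 + m.+1%:R^-1) - 1.
Proof.
have m0 : 0 < m.+1%:R :> R by [].
have m1 : 0 < m.+2%:R :> R by [].
rewrite /logfact (factS m.+1) natrM lnM ?posrE ?ltr0n ?fact_gt0//.
have -> : 1 + m.+1%:R^-1 = m.+2%:R / m.+1%:R :> R.
  by rewrite -[m.+2%:R]natr1; field; rewrite gt_eqF.
by rewrite ln_div ?posrE// -[m.+2%:R]natr1; ring.
Qed.

Let logfact_noninc : nonincreasing_seq logfact.
Proof.
apply/nonincreasing_seqP => m; rewrite -subr_ge0 logfactB subr_ge0.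
have m0 : 0 < m.+1%:R :> R by [].
have := @ln_ge_pade R (1 + m.+1%:R^-1); rewrite lerDl invr_ge0 (ltW m0) => /(_ isT).
have m2 : 0 <= m.+1%:R + 2^-1 :> R by lra.
move/(ler_wpM2l m2); apply: le_trans; rewrite le_eqVlt; apply/orP; left; apply/eqP.
by field; rewrite !gt_eqF//; lra.
Qed.

(* [logfact m - 1 / (4 (m + 1))] is nondecreasing. *)
Let logfact_ge m : logfact 0 - 1 / 4 <= logfact m.
Proof.
suff : logfact 0 - 1 / 4 <= logfact m - (4 * m.+1%:R)^-1.
  move/le_trans; apply; rewrite gerBl invr_ge0 mulr_ge0//.
elim: m => [|m IH]; first by rewrite mulr1 div1r.
apply: (le_trans IH); rewrite -subr_ge0.
have m0 : 0 < m.+1%:R :> R by [].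
have := @ln_le_sinh R (1 + m.+1%:R^-1); rewrite lerDl invr_ge0 (ltW m0) => /(_ isT).
have m2 : 0 <= m.+1%:R + 2^-1 :> R by lra.
move/(ler_wpM2l m2).
(* With a = m + 1 the bound exceeds 1 by 1 / (4 a (a + 1)), which telescopes; hence the correction 1
   / (4 (m + 1)), whose value at m = 0 is the 1/4 of the statement. *)
have -> : (m.+1%:R + 2^-1) * ((1 + m.+1%:R^-1 - (1 + m.+1%:R^-1)^-1) / 2) =
   1 + (4 * m.+1%:R)^-1 - (4 * m.+2%:R)^-1 :> R.
  by rewrite -[m.+2%:R]natr1; field; rewrite !gt_eqF//; lra.
have := logfactB m; clear; move: (logfact m) (logfact m.+1) => a b.
move: (_ * ln _) (4 * m.+1%:R)^-1 (4 * m.+2%:R)^-1 => x y z; lra.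
Qed.


(** The sequence [logfact] is nonincreasing and bounded below, hence convergent. Passing through
    logarithms makes c the exponential of a limit, so its positivity is automatic. *)
Lemma stirling : exists2 c : R, 0 < c &
  m`!%:R / (weight m m%:R * Num.sqrt m%:R) @[m --> \oo] --> c.
Proof.
have cvgl : cvgn logfact.
  apply: nonincreasing_is_cvgn => //; exists (logfact 0 - 1 / 4) => _ [m _ <-].
  exact: logfact_ge.
exists (expR (limn logfact)); first exact: expR_gt0.
rewrite -cvg_shiftS/=; under eq_fun do rewrite -expR_logfact.
by apply: continuous_cvg => //; exact: continuous_expR.
Qed.

Definition rescaled_weight m s : R :=
  weight m (Num.sqrt m%:R * s + m%:R) / weight m m%:R.

Lemma weight_diag_gt0 m : 0 < weight m m%:R.
Proof.
rewrite mulr_gt0 ?expR_gt0//; case: m => [|m]; first by rewrite expr0.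
exact: exprn_gt0.
Qed.

Lemma weight_ge0 m t : 0 <= t -> 0 <= weight m t.
Proof. by move=> t0; rewrite mulr_ge0 ?exprn_ge0// expR_ge0. Qed.

Lemma rescaled_weightE m s : (0 < m)%N -> 0 < 1 + s / Num.sqrt m%:R ->
  rescaled_weight m s =
  expR (m%:R * (ln (1 + s / Num.sqrt m%:R) - s / Num.sqrt m%:R)).
Proof.
move=> m0 u0; have m1 : 0 < m%:R :> R by rewrite ltr0n.
have m2 : 0 < Num.sqrt m%:R :> R by rewrite sqrtr_gt0.
rewrite expRM_natl expRB lnK ?posrE// /rescaled_weight /weight.
have -> : Num.sqrt m%:R * s + m%:R = m%:R * (1 + s / Num.sqrt m%:R).
  have mE : m%:R = Num.sqrt m%:R ^+ 2 :> R by rewrite sqr_sqrtr// ltW.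
  by rewrite [X in _ + X = _]mE [X in _ = X * _]mE; field; rewrite gt_eqF.
rewrite exprMn expr_div_n -expRM_natl !expRN.
have -> : m%:R * (1 + s / Num.sqrt m%:R) = m%:R + m%:R * (s / Num.sqrt m%:R) :> R.
  by ring.
rewrite expRD.
have e1 := expR_gt0 (m%:R : R); have e2 := expR_gt0 (m%:R * (s / Num.sqrt m%:R)).
have e3 : 0 < m%:R ^+ m :> R by rewrite exprn_gt0.
by field; rewrite !gt_eqF.
Qed.

Lemma rescaled_weight_ge0 m s : - Num.sqrt m%:R <= s -> 0 <= rescaled_weight m s.
Proof.
move=> sm; rewrite divr_ge0 ?(ltW (weight_diag_gt0 m))// weight_ge0//.
have := sqrtr_ge0 (m%:R : R) => h.
have mE : m%:R = Num.sqrt m%:R ^+ 2 :> R by rewrite sqr_sqrtr.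
by rewrite [X in _ + X]mE expr2 -mulrDr mulr_ge0// -lerBlDr sub0r.
Qed.

(** A bound uniform in m cannot be Gaussian: for m = 1 the right tail is (1 + s) exp(-s). With v = s
    / sqrt m, for s >= 0 the exponent is at most - s^2 / (2 (1 + v)), and v <= s because m >= 1, so
    s^2 - 1 <= s^2 gives the claim. For s < 0 the second-order Taylor bound gives - s^2 / 2, which
    is smaller still. *)
Lemma rescaled_weight_le m s : (0 < m)%N -> - Num.sqrt m%:R <= s ->
  rescaled_weight m s <= expR (2^-1 * (1 - `|s|)).
Proof.
move=> m0 sm; have m1 : 0 < m%:R :> R by rewrite ltr0n.
have m2 : 0 < Num.sqrt m%:R :> R by rewrite sqrtr_gt0.
(* The endpoint is t = 0, outside the range of [rescaled_weightE]; the weight vanishes there because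
   m > 0. *)
move: sm; rewrite le_eqVlt => /predU1P[<-|sm].
  have -> : rescaled_weight m (- Num.sqrt m%:R) = 0.
    rewrite /rescaled_weight mulrN -expr2 sqr_sqrtr ?ltW// addNr /weight.
    by rewrite expr0n gtn_eqF// !mul0r.
  exact: expR_ge0.
have u0 : 0 < 1 + s / Num.sqrt m%:R.
  by rewrite -(ltr_pM2r m2) mul0r mulrDl mul1r divfK ?gt_eqF// -ltrBlDl sub0r.
rewrite rescaled_weightE// ler_expR.
set v := s / Num.sqrt m%:R; rewrite -/v in u0.
have sv : s = v * Num.sqrt m%:R by rewrite /v divfK ?gt_eqF.
have s2 : s ^+ 2 = m%:R * v ^+ 2 by rewrite sv exprMn sqr_sqrtr ?ltW// mulrC.
have [s0|s0] := leP 0 s.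
  have v0 : 0 <= v by rewrite divr_ge0// ltW.
  have vs : v <= s.
    rewrite /v ler_pdivrMr// ler_peMr// -[leLHS](@sqrtr1 R) ler_sqrt//.
    by rewrite ler1n.
  have := @ln_le_sinh R (1 + v); rewrite lerDl v0 => /(_ isT) h.
  apply: (@le_trans _ _ (m%:R * (- (v ^+ 2 / (2 * (1 + v)))))).
    rewrite ler_pM2l// -subr_ge0; move: h; rewrite -subr_ge0.
    suff -> : (1 + v - (1 + v)^-1) / 2 - ln (1 + v) =
      - (v ^+ 2 / (2 * (1 + v))) - (ln (1 + v) - v) by [].
    by field; rewrite gt_eqF.
  rewrite mulrN mulrA -s2 (ger0_norm s0).
  rewrite lerNl ler_pdivlMr; last by lra.
  nra.
have v0 : v < 0 by rewrite pmulr_llt0 ?invr_gt0.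
have := @ln_taylor2_le R (1 + v); rewrite u0 gerDl (ltW v0) => /(_ isT).
rewrite (_ : 1 + v - 1 = v) => [h|]; last by ring.
rewrite (ltr0_norm s0).
have h2 : m%:R * (ln (1 + v) - v) <= m%:R * (- (v ^+ 2 / 2)).
  by rewrite ler_pM2l//; lra.
by apply: (le_trans h2); rewrite mulrN mulrA -s2; have := sqr_ge0 (s + 1); nra.
Qed.

End stirling.

(** * Laplace's method by dominated convergence *)

Section laplace.
Context (R : realType).
Implicit Types (c q s t : R) (m : nat).
Local Notation mu := (@lebesgue_measure R).

Lemma cvg_div_sqrt s : s / Num.sqrt m%:R @[m --> \oo] --> (0 : R).
Proof.
have h : s * Num.sqrt (harmonic m) @[m --> \oo] --> (0 : R).
  rewrite -[X in _ --> X](mulr0 s); apply: cvgM; first exact: cvg_cst.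
  rewrite -[X in _ --> X](@sqrtr0 R).
  by apply: continuous_cvg; [exact: sqrt_continuous|exact: cvg_harmonic].
rewrite -cvg_shiftS; apply: cvg_trans h; apply: near_eq_cvg; apply: nearW => m.
by rewrite /harmonic/= sqrtrV.
Qed.

(** On each side of 0 the Taylor bound gives the sign of the error, and the hyperbolic bound shows
    that its size is at most that of v^3 / (2 (1 + v)). The condition on v ensures 2 (1 + v) >=
    1. *)
Lemma ln1D_expansion (v : R) : `|v| <= 2^-1 ->
  `|ln (1 + v) - v + v ^+ 2 / 2| <= v ^+ 2 * `|v|.
Proof.
move=> v2; have /andP[v2' v2''] : - 2^-1 <= v <= 2^-1 by rewrite -ler_norml.
have u0 : 0 < 1 + v by lra.
have uV : (1 + v) - (1 + v)^-1 = v * (2 + v) / (1 + v) by field; rewrite gt_eqF.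
have hv : v ^+ 2 / 2 - v + v * (2 + v) / (1 + v) / 2 = v ^+ 2 * (v / (2 * (1 + v))).
  by field; rewrite gt_eqF.
have hv' : `|v / (2 * (1 + v))| <= `|v|.
  rewrite normrM ler_piMr// normfV ger0_norm; last by lra.
  by rewrite invf_le1; lra.
have [v0|v0] := leP 0 v.
  have h1 := @ln_taylor2_ge R (1 + v); have h2 := @ln_le_sinh R (1 + v).
  move: h1 h2; rewrite !lerDl v0 uV => /(_ isT) h1 /(_ isT) h2.
  rewrite ger0_norm; last by move: h1; rewrite (_ : 1 + v - 1 = v); [lra|ring].
  apply: (@le_trans _ _ (v ^+ 2 * (v / (2 * (1 + v))))); first by lra.
  by rewrite ler_wpM2l ?sqr_ge0// (le_trans _ hv')// ler_norm.
have h1 := @ln_taylor2_le R (1 + v); have h2 := @ln_ge_sinh R (1 + v).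
move: h1 h2; rewrite u0 gerDl (ltW v0) uV => /(_ isT) h1 /(_ isT) h2.
rewrite ler0_norm; last by move: h1; rewrite (_ : 1 + v - 1 = v); [lra|ring].
apply: (@le_trans _ _ (v ^+ 2 * - (v / (2 * (1 + v))))); first by lra.
by rewrite ler_wpM2l ?sqr_ge0// (le_trans _ hv')// -normrN ler_norm.
Qed.

(** With v = s / sqrt m one has m v^2 = s^2, so m times the cubic error of [ln1D_expansion] is s^2
    |v|, which tends to 0. *)
Lemma cvg_rescaled_weight q s :
  rescaled_weight m s `^ q @[m --> \oo] --> expR (- (s ^+ 2 / 2) * q).
Proof.
pose v m : R := s / Num.sqrt m%:R.
have v0 : v m @[m --> \oo] --> (0 : R) := @cvg_div_sqrt s.
have h : m%:R * (ln (1 + v m) - v m) @[m --> \oo] --> - (s ^+ 2 / 2).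
  have nv0 : s ^+ 2 * `|v m| @[m --> \oo] --> (0 : R).
    by rewrite -[X in _ --> X](mulr0 (s ^+ 2)) -(@normr0 _ R); apply: cvgM;
      [exact: cvg_cst|exact: cvg_norm].
  apply: (@squeeze_cvgr _ _ _ _ (fun m => - (s ^+ 2 / 2) - s ^+ 2 * `|v m|)
     (fun m => - (s ^+ 2 / 2) + s ^+ 2 * `|v m|)).
  - near=> m.
    have m0 : (0 < m)%N by near: m; exact: nbhs_infty_gt.
    have m1 : 0 < m%:R :> R by rewrite ltr0n.
    have m2 : 0 < Num.sqrt m%:R :> R by rewrite sqrtr_gt0.
    have s2 : s ^+ 2 = m%:R * v m ^+ 2.
      by rewrite /v expr_div_n sqr_sqrtr ?ltW// mulrC divfK ?gt_eqF.
    have : `|v m| <= 2^-1 by near: m; apply: cvgr0_norm_le.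
    move/ln1D_expansion; rewrite -(ler_pM2l m1) mulrA -s2.
    rewrite -[X in X * `|_|](ger0_norm (ltW m1)) -normrM.
    have -> : m%:R * (ln (1 + v m) - v m + v m ^+ 2 / 2) =
       m%:R * (ln (1 + v m) - v m) + s ^+ 2 / 2 by rewrite s2; ring.
    by rewrite ler_norml => /andP[? ?]; apply/andP; split; lra.
  - by rewrite -[X in _ --> X]subr0; apply: cvgB => //; exact: cvg_cst.
  - by rewrite -[X in _ --> X]addr0; apply: cvgD => //; exact: cvg_cst.
have : expR (m%:R * (ln (1 + v m) - v m) * q) @[m --> \oo] --> expR (- (s ^+ 2 / 2) * q).
  apply: continuous_cvg; first exact: continuous_expR.
  by apply: cvgM => //; exact: cvg_cst.
apply: cvg_trans; apply: near_eq_cvg; near=> m.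
rewrite rescaled_weightE ?expRM//; first by near: m; exact: nbhs_infty_gt.
have : `|v m| <= 2^-1 by near: m; apply: cvgr0_norm_le.
by rewrite -/(v m) ler_norml => /andP[? ?]; lra.
Unshelve. all: by end_near. Qed.

Lemma integrable_expR_normN c : 0 < c ->
  mu.-integrable setT (fun s => (expR (- (c * `|s|)))%:E).
Proof.
move=> c0.
have cf : continuous (fun s : R => expR (- (c * `|s|))).
  move=> s; apply: continuous_comp; last exact: continuous_expR.
  apply: continuousN; apply: continuousM; first exact: cst_continuous.
  exact: norm_continuous.
apply/integrableP; split.
  by apply/measurable_EFinP; exact: continuous_measurable_fun.
under eq_integral do rewrite gee0_abs ?lee_fin ?expR_ge0//.
rewrite ge0_symfun_integralT//; last by move=> s; rewrite /= normrN.
rewrite lte_mul_pinfty// (_ : [set x | 0 <= x] = `[0, +oo[%classic); last first.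
  by apply/seteqP; split => x; rewrite /= in_itv/= andbT.
rewrite integral_mkcond.
rewrite [X in (X < _)%E](_ : _ = (\int[mu]_s (c^-1%:E * (exponential_pdf c s)%:E)))%E.
  rewrite ge0_integralZl_EFin ?invr_ge0 ?ltW//.
  - by rewrite integral_exponential_pdf// mule1 ltry.
  - by move=> s _; rewrite lee_fin exponential_pdf_ge0// ltW.
  - by apply/measurable_EFinP; exact: measurable_exponential_pdf.
apply: eq_integral => s _; rewrite /exponential_pdf !patchE.
case: ifPn => [|_]; last by rewrite mule0.
rewrite inE/= in_itv/= andbT => s0.
by rewrite -EFinM mulKf ?gt_eqF// ger0_norm// mulNr.
Qed.

Lemma measurable_weight m : measurable_fun setT (@weight R m).
Proof.
apply: measurable_funM; first exact: measurable_funX.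
apply: (measurableT_comp (@measurable_expR R)); exact: measurable_funN.
Qed.

Lemma measurable_rescaled_weight q m :
  measurable_fun setT (fun s => rescaled_weight m s `^ q).
Proof.
apply: (measurableT_comp (@measurable_powR R q)).
apply: measurable_funM => //.
exact: (measurableT_comp (measurable_weight m) (measurable_affine _ _)).
Qed.

Let dominator q s := expR (q / 2) * expR (- (q / 2 * `|s|)).

Let rescaled_weight_dominated q m s : 0 < q -> (0 < m)%N -> - Num.sqrt m%:R <= s ->
  rescaled_weight m s `^ q <= dominator q s.
Proof.
move=> q0 m0 sm; rewrite /dominator -expRD.
have -> : q / 2 + - (q / 2 * `|s|) = 2^-1 * (1 - `|s|) * q by ring.
rewrite expRM ge0_ler_powR ?(ltW q0) ?nnegrE ?expR_ge0//.
- exact: rescaled_weight_ge0.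
- exact: rescaled_weight_le.
Qed.

Let rescaled_patch q m : R -> \bar R :=
  (fun s => (rescaled_weight m s `^ q)%:E) \_ `[- Num.sqrt m%:R, +oo[.

Let measurable_rescaled_patch q m : measurable_fun setT (rescaled_patch q m).
Proof.
apply/(measurable_restrict _ _ _) => //; rewrite setTI.
by apply: measurable_funTS; apply/measurable_EFinP; exact: measurable_rescaled_weight.
Qed.

Let rescaled_patch_le q m s : 0 < q -> (0 < m)%N ->
  (`|rescaled_patch q m s| <= (dominator q s)%:E)%E.
Proof.
move=> q0 m0; rewrite /rescaled_patch patchE.
case: ifPn => [|_]; last by rewrite abse0 lee_fin mulr_ge0// expR_ge0.
rewrite inE/= in_itv/= andbT => sm; rewrite lee_fin ger0_norm ?powR_ge0//.
exact: rescaled_weight_dominated.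
Qed.

Let integrable_dominator q : 0 < q ->
  mu.-integrable setT (fun s => (dominator q s)%:E).
Proof.
move=> q0; rewrite /dominator; under eq_fun do rewrite EFinM.
by apply: integrableZl => //; apply: integrable_expR_normN; rewrite divr_gt0.
Qed.

Definition laplace_integral q m : \bar R :=
  (\int[mu]_(s in `[(- Num.sqrt m%:R)%R, +oo[) (rescaled_weight m s `^ q)%:E)%E.

Lemma laplace_integral_fin_num q m : 0 < q -> (0 < m)%N ->
  laplace_integral q m \is a fin_num.
Proof.
move=> q0 m0; rewrite /laplace_integral integral_mkcond.
apply: integrable_fin_num => //.
apply: (le_integrable measurableT _ _ (integrable_dominator q0)).
  exact: measurable_rescaled_patch.
move=> s _; rewrite [leRHS]gee0_abs; first exact: rescaled_patch_le.
by rewrite lee_fin mulr_ge0// expR_ge0.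
Qed.

Lemma laplace_integral_cvg q : 0 < q -> exists2 L : R, 0 < L &
  laplace_integral q m @[m --> \oo] --> L%:E.
Proof.
move=> q0; pose g s := (expR (- (s ^+ 2 / 2) * q))%:E.
have mg : measurable_fun setT g.
  apply/measurable_EFinP/(measurableT_comp (@measurable_expR R)).
  apply: measurable_funM => //; apply: measurable_funN; apply: measurable_funM => //.
(* The index is shifted because the domination fails at m = 0, where the rescaled weight is
   constantly 1. *)
have [] := @dominated_convergence _ _ R mu setT measurableT
  (fun m => rescaled_patch q m.+1) g (fun s => (dominator q s)%:E) _ mg _
  (integrable_dominator q0).
- by move=> m; exact: measurable_rescaled_patch.
- apply: nearW => s _.
  apply: (@cvg_trans _ ((rescaled_weight m.+1 s `^ q)%:E @[m --> \oo])).
    apply: near_eq_cvg; near=> m; rewrite /rescaled_patch patchE ifT//.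
    rewrite inE/= in_itv/= andbT.
    have m0 : 0 < Num.sqrt m.+1%:R :> R by rewrite sqrtr_gt0.
    suff /ler_normlP[h _] : `|s / Num.sqrt m.+1%:R| <= 1.
      by rewrite lerNl -(ler_pM2r (x:=(Num.sqrt m.+1%:R)^-1)) ?invr_gt0// divff ?gt_eqF// mulNr.
    near: m; apply: cvgr0_norm_le => //.
    by have := @cvg_div_sqrt s; rewrite -cvg_shiftS.
  apply: cvg_EFin; first exact: nearW.
  rewrite (_ : fine \o _ = fun m => rescaled_weight m.+1 s `^ q)//.
  rewrite (cvg_shiftS (fun m => rescaled_weight m s `^ q)).
  exact: cvg_rescaled_weight.
- by apply: nearW => s m _; exact: rescaled_patch_le.
move=> ig _ cg.
have Lfin : (\int[mu]_x g x)%E \is a fin_num by exact: integrable_fin_num.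
exists (fine (\int[mu]_x g x)%E); last first.
  rewrite fineK// -cvg_shiftS; apply: cvg_trans cg.
  by apply: near_eq_cvg; apply: nearW => m; rewrite /laplace_integral [RHS]integral_mkcond.
rewrite -lte_fin fineK//.
(* Positivity of the limit: on [0, 1] the Gaussian is at least exp(- q / 2). *)
apply: (@lt_le_trans _ _ (\int[mu]_(x in `[0%R, 1%R]) (expR (- (1 / 2) * q))%:E)%E).
  rewrite integral_cst//= lebesgue_measure_itv/= lte_fin ltr01 oppr0 adde0 mule1.
  by rewrite lte_fin expR_gt0.
apply: (@le_trans _ _ (\int[mu]_(x in `[0%R, 1%R]) g x)%E).
  apply: ge0_le_integral => //.
  - exact: measurable_funTS.
  - move=> s; rewrite /= in_itv/= => /andP[s0 s1]; rewrite lee_fin ler_expR.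
    by rewrite ler_pM2r// lerN2 ler_pM2r ?invr_gt0// expr_le1.
apply: ge0_subset_integral => // s _.
exact: expR_ge0.
Unshelve. all: by end_near. Qed.

End laplace.

(** * One-variable norms *)

Section modes.
Context (R : realType).
Implicit Types (N m n : nat) (q x : R) (z : R[i]).
Local Notation mu := (@lebesgue_measure R).
Local Notation normc := ComplexField.Normc.normc.

(* The modulus of the one-variable function e_m. *)
Definition mode N m z : R :=
  Num.sqrt (N%:R / (pi * m`!%:R) * weight m (N%:R * sqrmod z)).

Lemma mode_ge0 N m z : 0 <= mode N m z. Proof. exact: sqrtr_ge0. Qed.

Lemma powR_half x n : 0 <= x -> x `^ (n%:R / 2) = Num.sqrt x ^+ n.
Proof.
by move=> x0; rewrite mulrC powRrM powR12_sqrt// powR_mulrn// sqrtr_ge0.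
Qed.

Lemma normcX z n : normc (z ^+ n) = normc z ^+ n.
Proof.
elim: n => [|n IH]; first by rewrite !expr0 ComplexField.Normc.normc1.
by rewrite !exprS ComplexField.Normc.normcM IH.
Qed.

Lemma normc_prod n (f : 'I_n -> R[i]) :
  normc (\prod_(j < n) f j) = \prod_(j < n) normc (f j).
Proof.
elim: n f => [|n IH] f; first by rewrite !big_ord0 ComplexField.Normc.normc1.
by rewrite !big_ord_recl ComplexField.Normc.normcM IH.
Qed.

Lemma normcR x : normc x%:C%C = `|x|.
Proof. by rewrite /ComplexField.Normc.normc/= expr0n addr0 sqrtr_sqr. Qed.

Lemma normcE z : normc z = Num.sqrt (sqrmod z).
Proof. by case: z. Qed.

Lemma sqrt_prod n (f : 'I_n -> R) : (forall j, 0 <= f j) ->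
  Num.sqrt (\prod_(j < n) f j) = \prod_(j < n) Num.sqrt (f j).
Proof.
elim: n f => [|n IH] f f0; first by rewrite !big_ord0 sqrtr1.
by rewrite !big_ord_recl sqrtrM// IH.
Qed.

Lemma modeE N m z : mode N m z =
  Num.sqrt N%:R ^+ m.+1 * expR (- (N%:R * normc z ^+ 2 / 2)) * normc z ^+ m
  / (Num.sqrt pi * Num.sqrt m`!%:R).
Proof.
rewrite -[RHS]ger0_norm; last first.
  rewrite divr_ge0 ?mulr_ge0 ?exprn_ge0 ?sqrtr_ge0 ?expR_ge0//.
  by rewrite normcE sqrtr_ge0.
rewrite -sqrtr_sqr; congr Num.sqrt.
have w0 := sqrmod_ge0 z.
have p0 : 0 < pi :> R := pi_gt0 R.
have f0 : 0 < m`!%:R :> R by rewrite ltr0n fact_gt0.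
rewrite expr_div_n !exprMn !sqr_sqrtr ?ltW// normcE sqr_sqrtr//.
rewrite [(_ ^+ m.+1) ^+ 2]exprAC [(_ ^+ m) ^+ 2]exprAC !sqr_sqrtr//.
rewrite -expRM_natl (_ : 2%:R * _ = - (N%:R * sqrmod z)); last by field.
rewrite /weight exprMn exprS.
by move: (pi : R) p0 => P p0; field; rewrite !gt_eqF.
Qed.

Lemma normc_bargmann_e N n (alpha : n.-tuple nat) (z : n.-tuple R[i]) :
  normc (bargmann_e N alpha z) = \prod_(j < n) mode N (tnth alpha j) (tnth z j).
Proof.
under [RHS]eq_bigr do rewrite modeE.
rewrite prodf_div !big_split/= !prodr_const !card_ord -expR_sum prodrXr.
have -> : (\sum_(i < n) (tnth alpha i).+1 = n + multiabs alpha)%N.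
  by under eq_bigr do rewrite -add1n; rewrite big_split/= sum1_card card_ord.
rewrite /bargmann_e !ComplexField.Normc.normcM ComplexField.Normc.normcV !normcR.
have -> : normc (multipow z alpha) = \prod_(j < n) normc (tnth z j) ^+ tnth alpha j.
  by rewrite /multipow normc_prod; apply: eq_bigr => j _; exact: normcX.
rewrite !powR_half ?pi_ge0// ger0_norm; last first.
  by rewrite mulr_ge0 ?exprn_ge0 ?sqrtr_ge0 ?expR_ge0.
rewrite ger0_norm; last by rewrite mulr_ge0 ?exprn_ge0 ?sqrtr_ge0.
congr (_ * expR _ * _ / (_ * _)).
- rewrite sumrN; congr (- _); rewrite /sqr_norm mulr_sumr mulr_suml.
  by apply: eq_bigr.
- by rewrite /multifact natr_prod sqrt_prod.
Qed.

Lemma measurable_mode N m : measurable_fun setT (mode N m).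
Proof.
have h : measurable_fun setT (fun t : R =>
    Num.sqrt (N%:R / (pi * m`!%:R) * weight m (N%:R * t + 0)) : R).
  apply: (measurableT_comp (continuous_measurable_fun (@sqrt_continuous R))).
  apply: measurable_funM => //.
  exact: (measurableT_comp (measurable_weight m) (measurable_affine _ _)).
have := measurableT_comp h (@measurable_sqrmod R).
by apply: eq_measurable_fun => z _ /=; rewrite addr0.
Qed.

Definition weight_integral q m : \bar R :=
  (\int[mu]_(t in `[0%R, +oo[) (weight m t `^ q)%:E)%E.

Lemma weight_integral_laplace q m : (0 < m)%N ->
  weight_integral q m =
  ((Num.sqrt m%:R * weight m m%:R `^ q)%:E * laplace_integral q m)%E.
Proof.
move=> m0; have m1 : 0 < m%:R :> R by rewrite ltr0n.
have m2 : 0 < Num.sqrt m%:R :> R by rewrite sqrtr_gt0.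
have mE : m%:R = Num.sqrt m%:R ^+ 2 :> R by rewrite sqr_sqrtr ?ltW.
pose F : R -> \bar R := (fun t => (weight m t `^ q)%:E) \_ `[0%R, +oo[.
have mF : measurable_fun setT F.
  apply/(measurable_restrict _ _ _) => //; rewrite setTI.
  apply: measurable_funTS; apply/measurable_EFinP.
  exact: (measurableT_comp (@measurable_powR R q) (measurable_weight m)).
have F0 t : (0 <= F t)%E by apply: erestrict_ge0 => s _; rewrite lee_fin powR_ge0.
have h := ge0_integral_affine m%:R m2 mF F0.
rewrite /weight_integral integral_mkcond -/F.
have -> : (\int[mu]_t F t =
    (Num.sqrt m%:R)%:E * \int[mu]_x F (Num.sqrt m%:R * x + m%:R)%R)%E.
  by rewrite h muleA -EFinM divff ?gt_eqF// mul1e.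
rewrite EFinM -muleA; congr (_ * _)%E.
rewrite /laplace_integral -ge0_integralZl_EFin ?powR_ge0//; last 2 first.
- by move=> s _; rewrite lee_fin powR_ge0.
- by apply: measurable_funTS; apply/measurable_EFinP; exact: measurable_rescaled_weight.
rewrite [RHS]integral_mkcond.
apply: eq_integral => s _; rewrite /F !patchE !mem_setE !in_itv/= !andbT.
have -> : (0 <= Num.sqrt m%:R * s + m%:R) = (- Num.sqrt m%:R <= s).
  by rewrite [X in _ + X]mE expr2 -mulrDr pmulr_rge0// -lerBlDr sub0r.
case: ifPn => [sm|//].
rewrite -EFinM -powRM ?(ltW (weight_diag_gt0 _ _)) ?rescaled_weight_ge0//.
by rewrite /rescaled_weight (mulrC (weight m m%:R)) divfK// gt_eqF// weight_diag_gt0.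
Qed.

(** The substitution around the peak degenerates at m = 0; there the integrand is exp(- q t), which
    is 1/q times the exponential density. *)
Lemma weight_integral0 q : 0 < q -> weight_integral q 0 = q^-1%:E.
Proof.
move=> q0; rewrite /weight_integral integral_mkcond.
transitivity (\int[mu]_s (q^-1%:E * (exponential_pdf q s)%:E))%E.
  apply: eq_integral => s _; rewrite /exponential_pdf !patchE.
  case: ifPn => [|_]; last by rewrite mule0.
  rewrite inE/= in_itv/= andbT => s0.
  by rewrite -EFinM mulKf ?gt_eqF// /weight expr0 mul1r -expRM mulNr mulrC mulNr.
rewrite ge0_integralZl_EFin ?invr_ge0 ?(ltW q0)//.
- by rewrite integral_exponential_pdf// mule1.
- by move=> s _; rewrite lee_fin exponential_pdf_ge0// ltW.
- by apply/measurable_EFinP; exact: measurable_exponential_pdf.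
Qed.

Lemma weight_integral_fin_num q m : 0 < q -> weight_integral q m \is a fin_num.
Proof.
move=> q0; case: m => [|m]; first by rewrite weight_integral0.
by rewrite weight_integral_laplace// fin_numM// laplace_integral_fin_num.
Qed.

Lemma weight_integral_ge0 q m : (0 <= weight_integral q m)%E.
Proof. by apply: integral_ge0 => t _; rewrite lee_fin powR_ge0. Qed.

Lemma integral_mode_powR p N m : 0 < p -> (0 < N)%N ->
  (\int[lebesgue_C]_z (mode N m z `^ p)%:E =
   ((N%:R / (pi * m`!%:R)) `^ (p / 2) * (disc_area R / N%:R))%:E
   * weight_integral (p / 2) m)%E.
Proof.
move=> p0 N0; have N1 : 0 < N%:R :> R by rewrite ltr0n.
have c0 : 0 <= N%:R / (pi * m`!%:R) :> R.
  by rewrite divr_ge0// mulr_ge0// ?pi_ge0.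
transitivity (\int[lebesgue_C]_z (((N%:R / (pi * m`!%:R)) `^ (p / 2))%:E *
   (weight m (N%:R * sqrmod z - 0) `^ (p / 2))%:E))%E.
  apply: eq_integral => z _; rewrite -EFinM; congr (_%:E).
  have w0 : 0 <= weight m (N%:R * sqrmod z - 0).
    by rewrite subr0 weight_ge0// mulr_ge0 ?sqrmod_ge0.
  rewrite subr0 in w0 *; rewrite -powRM// /mode -powR12_sqrt; last exact: mulr_ge0.
  by rewrite -powRrM (mulrC 2^-1).
have mF : measurable_fun setT (fun t : R => (weight m t `^ (p / 2))%:E).
  apply/measurable_EFinP.
  exact: (measurableT_comp (@measurable_powR R _) (measurable_weight m)).
rewrite ge0_integralZl_EFin ?powR_ge0//; last 2 first.
- by move=> z _; rewrite lee_fin powR_ge0.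
- apply: (measurableT_comp mF).
  exact: (measurableT_comp (measurable_affine _ _) (@measurable_sqrmod R)).
rewrite (ge0_integral_radial_affine 0 N1 mF); last by move=> t; rewrite lee_fin powR_ge0.
by rewrite oppr0 EFinM muleA.
Qed.

End modes.

Section mode_norms.
Context (R : realType).
Implicit Types (N m n : nat) (q x : R).

Lemma continuous_powR (a x : R) : 0 < x -> {for x, continuous (fun y : R => y `^ a)}.
Proof.
move=> x0; apply: differentiable_continuous; apply/derivable1_diffP.
by apply: ex_derive; exact: is_derive1_powR.
Qed.

Definition mode_mass (r : R) N m : R :=
  (N%:R / (pi * m`!%:R)) `^ (r / 2) * (disc_area R / N%:R)
  * fine (weight_integral (r / 2) m).

(* The L^p norm of [mode N m] for [0 < p]; the value at [-oo] is junk. *)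
Definition mode_norm (p : \bar R) N m : R :=
  match p with
  | r%:E => mode_mass r N m `^ r^-1
  | _ => Num.sqrt (N%:R / (pi * m`!%:R) * weight m m%:R)
  end.

Definition mode_exponent (p : \bar R) : R := 2^-1 - fine (p^-1)%E.

Lemma mode_mass_ge0 (r : R) N m : 0 <= mode_mass r N m.
Proof.
have d0 := disc_area_gt0 R.
by rewrite !mulr_ge0 ?powR_ge0 ?invr_ge0 ?(ltW d0)// fine_ge0// weight_integral_ge0.
Qed.

Lemma integral_mode_mass (r : R) N m : 0 < r -> (0 < N)%N ->
  (\int[lebesgue_C]_z (mode N m z `^ r)%:E = (mode_mass r N m)%:E)%E.
Proof.
move=> r0 N0; rewrite integral_mode_powR// /mode_mass [RHS]EFinM fineK//.
by apply: weight_integral_fin_num; rewrite divr_gt0.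
Qed.

Lemma mode_norm_ge0 p N m : 0 <= mode_norm p N m.
Proof. by case: p => [r||]; rewrite ?powR_ge0 ?sqrtr_ge0. Qed.

Lemma mode_norm0_gt0 p : (2%:E <= p)%E -> 0 < mode_norm p 1 0.
Proof.
case: p => [r||//]; rewrite ?lee_fin => r2.
  have r0 : 0 < r / 2 by lra.
  rewrite /= powR_gt0// /mode_mass weight_integral0//= mulr_gt0 ?invr_gt0//.
  rewrite !mulr_gt0 ?invr_gt0 ?disc_area_gt0// powR_gt0// mulr_gt0//.
  by rewrite invr_gt0 mulr_gt0// pi_gt0.
rewrite /= sqrtr_gt0 mulr_gt0 ?weight_diag_gt0// mulr_gt0// invr_gt0.
by rewrite mulr_gt0 ?pi_gt0.
Qed.

Lemma mode_exponentE (r : R) : r != 0 -> mode_exponent r%:E = 2^-1 - r^-1.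
Proof. by move=> r0; rewrite /mode_exponent inver (negbTE r0). Qed.

Lemma mode_exponenty : mode_exponent +oo = 2^-1.
Proof. by rewrite /mode_exponent invey subr0. Qed.

Lemma mode_exponent_ge0 p : (2%:E <= p)%E -> 0 <= mode_exponent p.
Proof.
case: p => [r||//]; rewrite ?lee_fin ?mode_exponenty ?invr_ge0// => r2.
rewrite mode_exponentE; last by rewrite gt_eqF//; lra.
by rewrite subr_ge0 lef_pV2 ?posrE//; lra.
Qed.

(** The normalisation of e_m contributes N^(1/2). For finite p the change of variable t = N |z|^2
    contributes 1/N to the integral, hence N^(-1/p) to the norm; a supremum is unaffected by it. *)
Lemma mode_normE p N m : (2%:E <= p)%E -> (0 < N)%N ->
  mode_norm p N m = N%:R `^ mode_exponent p * mode_norm p 1 m.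
Proof.
move=> p2 N0; have N1 : 0 < N%:R :> R by rewrite ltr0n.
have Nn : N%:R != 0 :> R by rewrite gt_eqF.
have f0 : 0 <= (pi * m`!%:R)^-1 :> R by rewrite invr_ge0 mulr_ge0// pi_ge0.
case: p p2 => [r||//]; rewrite ?lee_fin => r2.
  have r0 : 0 < r by lra.
  rewrite mode_exponentE ?gt_eqF//= /mode_mass.
  rewrite (powRM (r / 2) (ltW N1) f0) div1r divr1.
  set a := (_ ^-1) `^ (r / 2); set w := fine _.
  have a0 : 0 <= a by exact: powR_ge0.
  have w0 : 0 <= w by rewrite fine_ge0// weight_integral_ge0.
  have d0 := disc_area_gt0 R.
  have -> : N%:R `^ (r / 2) * a * (disc_area R / N%:R) * w =
    N%:R `^ (r / 2 - 1) * (a * disc_area R * w).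
    by rewrite powRB ?Nn ?implybT// powRr1 ?ltW//; field.
  rewrite powRM ?mulr_ge0 ?powR_ge0 ?(ltW d0)// -powRrM; congr (_ `^ _ * _).
  by field; rewrite gt_eqF.
rewrite mode_exponenty /= powR12_sqrt ?ltW//.
rewrite -sqrtrM ?ltW//; congr Num.sqrt.
by rewrite -mulrA div1r.
Qed.

(** Put q = p / 2 and w = [weight m m%:R]. The integral is of order w^q sqrt m, while Stirling makes
    (m!)^(-q) of order (w sqrt m)^(-q). The peak value cancels and leaves (sqrt m)^(1 - q), whose
    p-th root is m^(-d/2). For p = +oo only sqrt(w / m!) remains, of order m^(-1/4). *)
Lemma mode_norm_cvg p : (2%:E <= p)%E -> exists2 c : R, 0 < c &
  mode_norm p 1 m * m%:R `^ (mode_exponent p / 2) @[m --> \oo] --> c.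
Proof.
have [b b0 sb] := stirling R.
have sbV : (pi * (m`!%:R / (weight m m%:R * Num.sqrt m%:R)))^-1 @[m --> \oo]
    --> (pi * b)^-1.
  apply: cvgV; first by rewrite gt_eqF// mulr_gt0 ?pi_gt0.
  by apply: cvgM => //; exact: cvg_cst.
have pb0 : 0 < (pi * b)^-1 by rewrite invr_gt0 mulr_gt0 ?pi_gt0.
case: p => [r||//]; rewrite ?lee_fin => r2.
  have r0 : 0 < r by lra.
  have q0 : 0 < r / 2 by lra.
  have [L L0 cL] := laplace_integral_cvg q0.
  (* This is the r-th power of the norm stripped of its factor (sqrt m)^(1 - r/2), so that every
     remaining factor converges to a positive limit. *)
  pose X m := disc_area R * fine (laplace_integral (r / 2) m) *
     (pi * (m`!%:R / (weight m m%:R * Num.sqrt m%:R)))^-1 `^ (r / 2).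
  have X0 : 0 < disc_area R * L * (pi * b)^-1 `^ (r / 2).
    by rewrite !mulr_gt0 ?disc_area_gt0// powR_gt0.
  exists ((disc_area R * L * (pi * b)^-1 `^ (r / 2)) `^ r^-1); first exact: powR_gt0.
  have cX : X m @[m --> \oo] --> disc_area R * L * (pi * b)^-1 `^ (r / 2).
    apply: cvgM; first by apply: cvgM; [exact: cvg_cst|exact: fine_cvg cL].
    exact: (@continuous_cvg _ _ _ _ _ _ (fun y : R => y `^ (r / 2)) _
      (@continuous_powR _ _ pb0) sbV).
  have : X m `^ r^-1 @[m --> \oo] -->
      (disc_area R * L * (pi * b)^-1 `^ (r / 2)) `^ r^-1.
    exact: (@continuous_cvg _ _ _ _ _ _ (fun y : R => y `^ r^-1) _
      (@continuous_powR _ _ X0) cX).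
  apply: cvg_trans; apply: near_eq_cvg; near=> m.
  have m0 : (0 < m)%N by near: m; exact: nbhs_infty_gt.
  have m1 : 0 < m%:R :> R by rewrite ltr0n.
  have s0 : 0 < Num.sqrt m%:R :> R by rewrite sqrtr_gt0.
  have f0 : 0 < m`!%:R :> R by rewrite ltr0n fact_gt0.
  have w0 := weight_diag_gt0 R m.
  have p0 := pi_gt0 R.
  have l0 : 0 <= fine (laplace_integral (r / 2) m).
    by rewrite fine_ge0// integral_ge0// => s _; rewrite lee_fin powR_ge0.
  have -> : mode_norm r%:E 1 m = (X m * Num.sqrt m%:R `^ (1 - r / 2)) `^ r^-1.
    rewrite /= /mode_mass /X weight_integral_laplace// fineM//; last first.
      exact: laplace_integral_fin_num.
    rewrite /= !divr1; congr (_ `^ _).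
    set l := fine _; set w := weight m m%:R; set s := Num.sqrt m%:R.
    have -> : (pi * (m`!%:R / (w * s)))^-1 = (1 / (pi * m`!%:R)) * w * s.
      by move: (pi : R) p0 => P P0; rewrite /w /s; field; rewrite !gt_eqF.
    rewrite !powRM ?mulr_ge0 ?(ltW w0) ?(ltW s0)// ?div1r ?invr_ge0 ?mulr_ge0 ?(ltW p0)//.
    rewrite powRB ?(gt_eqF s0) ?implybT// powRr1 ?(ltW s0)//.
    have h := powR_gt0 (r / 2) s0; by field; rewrite gt_eqF.
  rewrite powRM ?powR_ge0//; last first.
    by rewrite !mulr_ge0 ?powR_ge0// ltW// disc_area_gt0.
  rewrite -powR12_sqrt ?ltW// -!powRrM -mulrA -powRD ?(gt_eqF m1) ?implybT//.
  rewrite mode_exponentE ?gt_eqF// (_ : _ + _ = 0) ?powRr0 ?mulr1//.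
  by field; rewrite gt_eqF.
exists (Num.sqrt (pi * b)^-1); first by rewrite sqrtr_gt0.
have : Num.sqrt (pi * (m`!%:R / (weight m m%:R * Num.sqrt m%:R)))^-1 @[m --> \oo]
   --> Num.sqrt (pi * b)^-1.
  exact: (@continuous_cvg _ _ _ _ _ _ Num.sqrt _ (@sqrt_continuous R _) sbV).
apply: cvg_trans; apply: near_eq_cvg; near=> m.
have m0 : (0 < m)%N by near: m; exact: nbhs_infty_gt.
have m1 : 0 < m%:R :> R by rewrite ltr0n.
have s0 : 0 < Num.sqrt m%:R :> R by rewrite sqrtr_gt0.
have f0 : 0 < m`!%:R :> R by rewrite ltr0n fact_gt0.
have w0 := weight_diag_gt0 R m.
have p0 := pi_gt0 R.
rewrite mode_exponenty powRrM !powR12_sqrt ?powR_ge0 ?ltW//= -sqrtrM; last first.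
  by rewrite mulr_ge0 ?divr_ge0 ?mulr_ge0 ?(ltW p0) ?(ltW w0).
congr Num.sqrt.
by move: (pi : R) p0 => P P0; field; rewrite !gt_eqF.
Unshelve. all: by end_near. Qed.

End mode_norms.

(** * Tensor products and conclusion *)

Section tensor.
Context (R : realType).
Implicit Types (n : nat).
Local Notation mu := (@lebesgue_C R).

Lemma measurable_tensor n (g : 'I_n -> R[i] -> R) :
  (forall j, measurable_fun setT (g j)) ->
  measurable_fun setT (fun z : n.-tuple R[i] => \prod_(j < n) g j (tnth z j)).
Proof.
move=> mg; apply: measurable_prod => j _.
exact: (measurableT_comp (mg j) (measurable_tnth j)).
Qed.

Lemma tensor_cons n (g : 'I_n.+1 -> R[i] -> R) x (y : n.-tuple R[i]) :
  \prod_(j < n.+1) g j (tnth (Defs.cons_tuple (x, y)) j) =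
  g ord0 x * \prod_(j < n) g (lift ord0 j) (tnth y j).
Proof.
rewrite big_ord_recl tnth0; congr (_ * _).
by apply: eq_bigr => j _; rewrite tnthS.
Qed.

Lemma integral_tensor n (g : 'I_n -> R[i] -> R) (I : 'I_n -> R) :
  (forall j, measurable_fun setT (g j)) -> (forall j z, 0 <= g j z) ->
  (forall j, \int[mu]_z (g j z)%:E = (I j)%:E)%E ->
  (\int[lebesgue_Cn n]_z (\prod_(j < n) g j (tnth z j))%:E = (\prod_(j < n) I j)%:E)%E.
Proof.
elim: n g I => [|n IH] g I mg g0 gI.
  rewrite [LHS]integral_dirac//= ?diracT ?mul1e ?big_ord0//.
  by apply/measurable_EFinP; exact: measurable_tensor.
have IHn := IH _ _ (fun j => mg (lift ord0 j)) (fun j => g0 (lift ord0 j))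
  (fun j => gI (lift ord0 j)).
have mP := measurable_tensor (fun j => mg (lift ord0 j)).
pose F (z : n.+1.-tuple R[i]) := (\prod_(j < n.+1) g j (tnth z j))%:E.
have mF : measurable_fun setT F by apply/measurable_EFinP; exact: measurable_tensor.
have F0 z : (0 <= F z)%E by rewrite lee_fin prodr_ge0.
(* The measure on C^(n+1) is by definition the image of the product measure under [cons_tuple],
   which brings the integral into the form required by Tonelli. *)
transitivity (\int[(lebesgue_C \x lebesgue_Cn n)%E]_w F (Defs.cons_tuple w))%E.
  have := ge0_integral_pushforward (@measurable_cons_tuple R n)
    (lebesgue_C \x lebesgue_Cn n)%E measurableT mF (fun z _ => F0 z).
  rewrite preimage_setT => <-.
  by apply: eq_measure_integral; [exact: measurable_cons_tuple|move=> *].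

have mG : measurable_fun setT (fun w : R[i] * n.-tuple R[i] => F (Defs.cons_tuple w)).
  exact: (measurableT_comp mF (@measurable_cons_tuple R n)).
rewrite (fubini_tonelli1 (fun w => F (Defs.cons_tuple w)))//=.
transitivity (\int[mu]_x ((g ord0 x)%:E * (\prod_(j < n) I (lift ord0 j))%:E))%E.
  apply: eq_integral => x _; rewrite /fubini_F/=.
  under eq_integral do rewrite /F tensor_cons EFinM.
  rewrite ge0_integralZl_EFin ?IHn//.
  - by move=> y _; rewrite lee_fin prodr_ge0.
  - exact/measurable_EFinP.
have I0 : 0 <= \prod_(j < n) I (lift ord0 j).
  rewrite prodr_ge0// => j _; rewrite -lee_fin -gI.
  by apply: integral_ge0 => z _; rewrite lee_fin.
rewrite ge0_integralZr//.
- by rewrite gI big_ord_recl EFinM.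
- exact/measurable_EFinP.
- by move=> x _; rewrite lee_fin.
Qed.

(* A form of "f has essential supremum M" which passes to tensor products
   without null sets. *)
Definition attained_sup d (T : measurableType d) (nu : {measure set T -> \bar R})
    (f : T -> R) (M : R) :=
  (forall x, f x <= M) /\ forall a, a < M -> (0 < nu [set x | (a < f x)%R])%E.

(** If the essential supremum e were below M, the set where f > e would have positive measure,
    although it lies in the null set on which the bound by e fails. *)
Lemma attained_sup_Lnorm d (T : measurableType d) (nu : {measure set T -> \bar R})
    (f : T -> R) (M : R) : (forall x, 0 <= f x) -> measurable_fun setT f ->
  attained_sup nu f M -> ('N[nu]_+oo [ EFin \o f ] = M%:E)%E.
Proof.
move=> f0 mf [fM Mf].
have mfa a : measurable [set x | a < f x].
  rewrite (_ : mkset _ = f @^-1` `]a, +oo[); last first.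
    by apply/seteqP; split => x; rewrite /= in_itv/= andbT.
  by rewrite -[X in measurable X]setTI; exact: mf.
(* The norm at [+oo] is the essential supremum only when the whole space has positive measure. *)
have nuT : (0 < nu setT)%E.
  apply: (lt_le_trans (Mf (M - 1) _)); first by rewrite ltrBlDr ltrDl.
  by apply: le_measure; rewrite ?inE.
rewrite unlock nuT; apply/eqP; rewrite eq_le; apply/andP; split.
  apply/ess_supP; apply: nearW => x /=; rewrite lee_fin ger0_norm//.
rewrite leNgt; apply/negP => eM.
have e0 : (0 <= ess_sup nu (abse \o (EFin \o f)))%E.
  by apply: ess_sup_gee => //; apply: nearW => x /=; rewrite lee_fin.
move: eM e0; set e := ess_sup _ _ => eM e0.
have ef : e \is a fin_num by rewrite ge0_fin_numE// (lt_trans eM)// ltry.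
have {}eM : fine e < M by rewrite -lte_fin fineK.
have := Mf _ eM; rewrite lt_neqAle => /andP[/eqP h _]; apply: h; apply/esym.
have [A [mA A0 sA]] := ess_sup_ge nu (abse \o (EFin \o f)).
apply/eqP; rewrite eq_le measure_ge0 andbT -A0; apply: le_measure; rewrite ?inE//.
move=> x /= ex; apply: sA => /=; apply/negP; rewrite -ltNge -/e.
by rewrite -(fineK ef) lte_fin ger0_norm.
Qed.

(** A threshold below the product of the suprema splits as a product of thresholds, one below the
    first supremum and one below the product of the others. The superlevel set then contains a
    rectangle whose two sides have positive measure. *)
Lemma attained_sup_tensor n (g : 'I_n -> R[i] -> R) (M : 'I_n -> R) :
  (forall j, measurable_fun setT (g j)) -> (forall j z, 0 <= g j z) ->
  (forall j, 0 < M j) -> (forall j, attained_sup mu (g j) (M j)) ->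
  attained_sup (lebesgue_Cn n) (fun z => \prod_(j < n) g j (tnth z j))
    (\prod_(j < n) M j).
Proof.
elim: n g M => [|n IH] g M mg g0 M0 gM.
  split=> [z|a]; rewrite !big_ord0// => a1.
  rewrite (_ : [set _ | _] = setT); last first.
    by apply/seteqP; split => // z _; rewrite /= big_ord0.
  by rewrite /= diracT.
have [IHle IHgt] := IH _ _ (fun j => mg (lift ord0 j)) (fun j => g0 (lift ord0 j))
  (fun j => M0 (lift ord0 j)) (fun j => gM (lift ord0 j)).
have [gM0 M0g] := gM ord0.
split=> [z|a aM].
  by rewrite ler_prod// => j _; rewrite g0/=; have [] := gM j.
move: aM; rewrite big_ord_recl.
set P := \prod_(j < n) M (lift ord0 j) => aM.
have P0 : 0 < P by apply: prodr_gt0 => j _.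
have M00 := M0 ord0.
(* A nonnegative threshold allows the two strict inequalities to be multiplied. *)
pose a' := Num.max a 0.
have a'0 : 0 <= a' by rewrite le_max lexx orbT.
have a'M : a' < M ord0 * P by rewrite gt_max aM mulr_gt0.
(* Any b strictly between a'/P and [M ord0] works: b is below the first supremum and a'/b is below
   P. *)
pose b := (a' / P + M ord0) / 2.
have aP : a' / P < M ord0 by rewrite ltr_pdivrMr.
have aP0 : 0 <= a' / P by rewrite divr_ge0// ltW.
have b0 : 0 < b by rewrite /b; lra.
have bM : b < M ord0 by rewrite /b; lra.
have ab : a' / b < P.
  by rewrite ltr_pdivrMr// mulrC -ltr_pdivrMr// /b; lra.
have mA : measurable [set x | b < g ord0 x].
  rewrite (_ : mkset _ = g ord0 @^-1` `]b, +oo[); last first.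
    by apply/seteqP; split => x; rewrite /= in_itv/= andbT.
  by rewrite -[X in measurable X]setTI; exact: (mg ord0).
have mB : measurable [set y : n.-tuple R[i] |
    a' / b < \prod_(j < n) g (lift ord0 j) (tnth y j)].
  rewrite (_ : mkset _ = (fun y : n.-tuple R[i] =>
      \prod_(j < n) g (lift ord0 j) (tnth y j)) @^-1` `](a' / b), +oo[); last first.
    by apply/seteqP; split => x; rewrite /= in_itv/= andbT.
  rewrite -[X in measurable X]setTI.
  exact: (measurable_tensor (fun j => mg (lift ord0 j))).
have : (0 < (lebesgue_C \x lebesgue_Cn n)
   ([set x | (b < g ord0 x)%R] `*`
    [set y : n.-tuple R[i] | (a' / b < (\prod_(j < n) g (lift ord0 j) (tnth y j)))%R]))%E.
  by rewrite product_measure1E// mule_gt0// ?M0g// IHgt.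
move/lt_le_trans; apply.
rewrite -[leRHS]/((lebesgue_C \x lebesgue_Cn n)%E (@Defs.cons_tuple R n @^-1`
  [set z | (a < \prod_(j < n.+1) g j (tnth z j))%R])).
apply: le_measure; rewrite ?inE.
- exact: measurableX.
- rewrite -[X in measurable X]setTI; apply: measurable_cons_tuple => //.
  rewrite (_ : mkset _ = (fun z : n.+1.-tuple R[i] =>
      \prod_(j < n.+1) g j (tnth z j)) @^-1` `]a, +oo[); last first.
    by apply/seteqP; split => x; rewrite /= in_itv/= andbT.
  by rewrite -[X in measurable X]setTI; exact: (measurable_tensor mg).
move=> [x y] /= [bx ay]; rewrite tensor_cons.
apply: (@le_lt_trans _ _ a'); first by rewrite le_max lexx.
rewrite -(@divfK _ b _ a') ?gt_eqF// mulrC.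
by apply: ltr_pM => //; [exact: ltW|exact: divr_ge0 a'0 (ltW b0)].
Qed.

End tensor.

(** * Essential suprema and the product formula for the norms *)

Section Lp_norms.
Context (R : realType).
Implicit Types (N m n : nat) (a t : R).

(** For m > 0 this is 1 + x <= exp(x) at x = t/m - 1, raised to the power m. *)
Lemma weight_le m t : 0 <= t -> weight m t <= weight m m%:R.
Proof.
move=> t0; rewrite /weight; case: m => [|m].
  by rewrite !expr0 !mul1r ler_expR oppr0 oppr_le0.
have m0 : 0 < m.+1%:R :> R by [].
have : (t / m.+1%:R) ^+ m.+1 <= expR (t / m.+1%:R - 1) ^+ m.+1.
  rewrite lerXn2r ?nnegrE ?expR_ge0 ?divr_ge0//.
  by have := expR_ge1Dx (t / m.+1%:R - 1); rewrite addrCA subrr addr0.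
rewrite -expRM_natl mulrBr mulr1 mulrCA divff ?gt_eqF// mulr1 expRB.
rewrite expr_div_n ler_pdivrMr ?exprn_gt0// !expRN => h.
rewrite ler_pdivrMr ?expR_gt0//; apply: (le_trans h).
by rewrite le_eqVlt; apply/orP; left; apply/eqP; ring.
Qed.

Lemma continuous_weight m : continuous (@weight R m).
Proof.
move=> t; apply: (@continuousM _ _ (fun t : R => t ^+ m) (fun t : R => expR (- t))).
  exact: exprn_continuous.
by apply: continuous_comp; [exact: opp_continuous|exact: continuous_expR].
Qed.

(** The maximum is reached where N |z|^2 = m. By continuity the function stays above a on an annulus
    m <= N |z|^2 < m + e, of positive area. Taking the outer side only covers m = 0 as well. *)
Lemma mode_attained_sup N m : (0 < N)%N ->
  attained_sup lebesgue_C (@mode R N m) (mode_norm +oo N m).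
Proof.
move=> N0; have N1 : 0 < N%:R :> R by rewrite ltr0n.
have c0 : 0 < N%:R / (pi * m`!%:R) :> R.
  by rewrite divr_gt0// mulr_gt0 ?pi_gt0// ltr0n fact_gt0.
split=> [z|a aM].
  rewrite /mode /= ler_wsqrtr// ler_pM2l// weight_le// mulr_ge0//.
  exact: sqrmod_ge0.
pose f t : R := Num.sqrt (N%:R / (pi * m`!%:R) * weight m t).
have cf : {for m%:R, continuous f}.
  apply: continuous_comp; last exact: sqrt_continuous.
  by apply: continuousM; [exact: cst_continuous|exact: continuous_weight].
have /nbhs_ballP[e /= e0 he] : \forall t \near (m%:R : R), a < f t.
  by have := cvgr_gt _ cf; apply.
have mA : measurable
    (`[(m%:R / N%:R)%R, ((m%:R + e) / N%:R)%R[%classic : set (measurableTypeR R)).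
  exact: measurable_itv.
have Ae : lebesgue_C (@sqrmod R @^-1`
    `[(m%:R / N%:R)%R, ((m%:R + e) / N%:R)%R[) = (disc_area R * (e / N%:R))%:E.
  rewrite lebesgue_C_sqrmod// setIidl; last first.
    move=> x; rewrite /= !in_itv/= andbT => /andP[+ _]; apply: le_trans.
    by rewrite divr_ge0.
  rewrite lebesgue_measure_itv/= lte_fin ltr_pM2r ?invr_gt0// ltrDl e0.
  by rewrite -EFinB -EFinM -mulrBl addrAC subrr add0r.
apply: (@lt_le_trans _ _ (lebesgue_C (@sqrmod R @^-1`
   `[(m%:R / N%:R)%R, ((m%:R + e) / N%:R)%R[))).
  by rewrite Ae lte_fin mulr_gt0 ?disc_area_gt0// divr_gt0.
apply: le_measure; rewrite ?inE.
- by rewrite -[X in measurable X]setTI; exact: measurable_sqrmod.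
- rewrite (_ : mkset _ = mode N m @^-1` `]a, +oo[); last first.
    by apply/seteqP; split => x; rewrite /= in_itv/= andbT.
  by rewrite -[X in measurable X]setTI; exact: measurable_mode.
move=> z; rewrite /= in_itv/= => /andP[]; rewrite ler_pdivrMr// ltr_pdivlMr// => mz zm.
apply: he; rewrite /ball/= ler0_norm ?subr_le0 mulrC// opprB ltrBlDl//.
Qed.

Lemma powR_prod n (x : 'I_n -> R) a : (forall j, 0 <= x j) ->
  (\prod_(j < n) x j) `^ a = \prod_(j < n) x j `^ a.
Proof.
elim: n x => [|n IH] x x0; first by rewrite !big_ord0 powR1.
by rewrite !big_ord_recl powRM ?prodr_ge0// IH.
Qed.

Lemma mode_normy_gt0 N m : (0 < N)%N -> 0 < mode_norm +oo N m :> R.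
Proof.
move=> N0; rewrite /= sqrtr_gt0 mulr_gt0 ?weight_diag_gt0// divr_gt0 ?ltr0n//.
by rewrite mulr_gt0 ?pi_gt0// ltr0n fact_gt0.
Qed.

Lemma Lp_norm_bargmann_e (p : \bar R) N n (alpha : n.-tuple nat) :
  (2%:E <= p)%E -> (0 < N)%N ->
  Lp_norm p (bargmann_e N alpha) = (\prod_(j < n) mode_norm p N (tnth alpha j))%:E.
Proof.
move=> p2 N0; rewrite /Lp_norm.
rewrite (_ : (fun z => _) = EFin \o
  (fun z => \prod_(j < n) @mode R N (tnth alpha j) (tnth z j))); last first.
  by apply/funext => z /=; rewrite normc_bargmann_e.
case: p p2 => [r||//]; rewrite ?lee_fin => r2.
  have r0 : 0 < r by lra.
  rewrite unlock.
  under eq_integral.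
    move=> z _; rewrite /= ger0_norm; last by rewrite prodr_ge0// => j _; exact: mode_ge0.
    rewrite powR_prod; last by move=> j; exact: mode_ge0.
    over.
  rewrite (integral_tensor (g := fun j z => mode N (tnth alpha j) z `^ r)
    (I := fun j => mode_mass r N (tnth alpha j)))//.
  - by rewrite poweR_EFin powR_prod// => j; exact: mode_mass_ge0.
  - move=> j; apply: (measurableT_comp (@measurable_powR R r)); exact: measurable_mode.
  - by move=> j z; exact: powR_ge0.
  - by move=> j; exact: integral_mode_mass.
apply: attained_sup_Lnorm.
- by move=> z; rewrite prodr_ge0// => j _; exact: mode_ge0.
- apply: (measurable_tensor (g := fun j => mode N (tnth alpha j))) => j.
  exact: measurable_mode.
apply: (attained_sup_tensor (g := fun j => mode N (tnth alpha j))).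
- by move=> j; exact: measurable_mode.
- by move=> j z; exact: mode_ge0.
- by move=> j; exact: mode_normy_gt0.
- by move=> j; exact: mode_attained_sup.
Qed.

End Lp_norms.

(** * Uniform bounds and equivalents as N tends to infinity *)

Section asymptotics.
Context (R : realType).
Implicit Types (N m n : nat).

Lemma asymp_equiv_EFin (a b : nat -> R) : (\forall N \near \oo, 0 < b N) ->
  asymp_equiv (fun N => (a N)%:E) (fun N => (b N)%:E) <->
  a N / b N @[N --> \oo] --> (1 : R).
Proof.
move=> b0.
have E : \forall N \near \oo, ((a N)%:E / (b N)%:E = (a N / b N)%:E)%E.
  by near=> N; rewrite inver gt_eqF//; near: N.
split=> h.
  have /fine_cvg : ((a N / b N)%:E @[N --> \oo] --> 1%:E)%E.
    by apply: cvg_trans h; apply: near_eq_cvg; near=> N; rewrite -(near E N).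
  by [].
have : ((a N / b N)%:E @[N --> \oo] --> 1%:E)%E.
  by apply: cvg_EFin => //; exact: nearW.
apply: cvg_trans; apply: near_eq_cvg; near=> N; by rewrite (near E N).
Unshelve. all: by end_near. Qed.

Lemma asymp_linear_ge (lambda : R) (k : nat -> nat) : 0 < lambda ->
  (k N)%:R / (lambda * N%:R) @[N --> \oo] --> (1 : R) ->
  \forall N \near \oo, lambda * N%:R / 2 <= (k N)%:R.
Proof.
move=> l0 h; near=> N.
have N0 : (0 < N)%N by near: N; exact: nbhs_infty_gt.
have N1 : 0 < N%:R :> R by rewrite ltr0n.
have : 2^-1 <= (k N)%:R / (lambda * N%:R) :> R.
  by near: N; apply: (cvgr_ge _ h); rewrite invf_lt1// ltr1n.
by rewrite ler_pdivlMr ?mulr_gt0// mulrC.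
Unshelve. all: by end_near. Qed.

(** The factor m + 1 in place of m keeps the bound meaningful for zero components. In K the first
    term covers m = 0; for m >= 1 the bound on the convergent sequence is used with m + 1 <= 2 m,
    whence the factor 2^(d/2). *)
Lemma mode_norm_bound (p : \bar R) : (2%:E <= p)%E -> exists2 K : R, 0 < K &
  forall m, mode_norm p 1 m * m.+1%:R `^ (mode_exponent p / 2) <= K.
Proof.
move=> p2; have [c c0 hc] := mode_norm_cvg p2.
have [B [_ /(_ (B + 1))]] := cvg_seq_bounded (cvgP _ hc).
rewrite ltrDl ltr01 => /(_ isT) hB.
have d0 : 0 <= mode_exponent p / 2 by rewrite divr_ge0// mode_exponent_ge0.
have k0 := mode_norm0_gt0 p2.
have B0 : 0 <= B + 1 by apply: le_trans (hB 0 I); exact: normr_ge0.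
have t0 : 0 <= 2 `^ (mode_exponent p / 2) :> R by exact: powR_ge0.
exists (mode_norm p 1 0 + (B + 1) * 2 `^ (mode_exponent p / 2)).
  by rewrite ltr_wpDr// mulr_ge0.
case=> [|m]; first by rewrite powR1 mulr1 lerDl mulr_ge0.
apply: (@le_trans _ _ ((B + 1) * 2 `^ (mode_exponent p / 2))); last first.
  by rewrite lerDr ltW.
have := hB m.+1 I; rewrite /= ger0_norm ?mulr_ge0 ?mode_norm_ge0 ?powR_ge0// => h.
apply: (@le_trans _ _ (mode_norm p 1 m.+1 *
    (m.+1%:R `^ (mode_exponent p / 2) * 2 `^ (mode_exponent p / 2)))).
  rewrite ler_wpM2l ?mode_norm_ge0// -powRM// (ge0_ler_powR d0) ?nnegrE ?mulr_ge0//.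
  by have : 1 <= m.+1%:R :> R; [rewrite ler1n|rewrite -[m.+2%:R]natr1; lra].
by rewrite mulrA ler_wpM2r.
Qed.

Lemma multiabs_lt_prod n (nu : n.-tuple nat) :
  (multiabs nu < \prod_(j < n) (tnth nu j).+1)%N.
Proof.
rewrite /multiabs; elim: n nu => [|n IH] nu; first by rewrite !big_ord0.
rewrite !big_ord_recl.
have := IH [tuple tnth nu (lift ord0 j) | j < n].
under eq_bigr do rewrite tnth_mktuple.
under [X in (_ < X)%N -> _]eq_bigr do rewrite tnth_mktuple.
move: (\sum_(_ < _) _)%N (\prod_(_ < _) _)%N (tnth nu ord0) => s P a sP.
by rewrite mulSn (leq_ltn_trans _ (leq_add sP (leq_pmulr a (leq_ltn_trans _ sP))))// addnC.
Qed.

End asymptotics.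

Theorem corollary2p6p1 (R : realType) (n : nat) (n_gt0 : (0 < n)%N)
    (lambda : R) (lambda_gt0 : 0 < lambda)
    (p : \bar R) (p_ge2 : (2%:E <= p)%E) :
  (exists2 C : R, 0 < C &
    forall k : nat -> nat,
      asymp_equiv (fun N => (k N)%:R%:E) (fun N => (lambda * N%:R)%:E) ->
      \forall N \near \oo, forall nu : n.-tuple nat, multiabs nu = k N ->
        (Lp_norm p (bargmann_e N nu)
         <= (C * N%:R `^ ((n%:R - 2^-1) * (2^-1 - fine (p^-1)%E)))%:E)%E)
  /\
  (exists2 C' : R, 0 < C' &
    forall k : nat -> nat,
      asymp_equiv (fun N => (k N)%:R%:E) (fun N => (lambda * N%:R)%:E) ->
      asymp_equiv
        (fun N => Lp_norm p (bargmann_e N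
                    [tuple if val j == 0%N then k N else 0%N | j < n]))
        (fun N => (C' * N%:R `^ ((n%:R - 2^-1) * (2^-1 - fine (p^-1)%E)))%:E)).
Proof.
rewrite -/(mode_exponent p); set d := mode_exponent p.
have d0 : 0 <= d := mode_exponent_ge0 p_ge2.
have lN0 : \forall N \near \oo, 0 < lambda * N%:R.
  near=> N; rewrite mulr_gt0// ltr0n; near: N; exact: nbhs_infty_gt.
split.
  have [K K0 hK] := mode_norm_bound p_ge2.
  (* Each of the n factors contributes K, and |nu| >= lambda N / 2 contributes the denominator. *)
  exists (K ^+ n / (lambda / 2) `^ (d / 2)).
    by rewrite divr_gt0 ?exprn_gt0// powR_gt0 ?divr_gt0.
  move=> k /(asymp_equiv_EFin _ lN0) hk; near=> N => nu nuk.
  have N0 : (0 < N)%N by near: N; exact: nbhs_infty_gt.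
  have N1 : 0 < N%:R :> R by rewrite ltr0n.
  have kN : lambda * N%:R / 2 <= (k N)%:R by near: N; exact: asymp_linear_ge.
  rewrite Lp_norm_bargmann_e// lee_fin.
  under eq_bigr do rewrite mode_normE//.
  rewrite big_split/= prodr_const card_ord -/d.
  have h : (\prod_(j < n) mode_norm p 1 (tnth nu j)) * (lambda * N%:R / 2) `^ (d / 2) <= K ^+ n.
    apply: (@le_trans _ _ (\prod_(j < n) (mode_norm p 1 (tnth nu j) *
        (tnth nu j).+1%:R `^ (d / 2)))).
      rewrite big_split/= -powR_prod// ler_wpM2l ?prodr_ge0//.
        by move=> j _; exact: mode_norm_ge0.
      rewrite ge0_ler_powR ?nnegrE ?divr_ge0 ?mulr_ge0 ?(ltW lambda_gt0) ?prodr_ge0//.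
      by rewrite (le_trans kN)// -natr_prod ler_nat -nuk ltnW// multiabs_lt_prod.
    have -> : K ^+ n = \prod_(j < n) K by rewrite prodr_const card_ord.
    rewrite ler_prod// => j _.
    by rewrite hK mulr_ge0 ?mode_norm_ge0 ?powR_ge0.
  (* The term d n is the scaling of the n factors in N; - d/2 is the decay in |nu|, which is at
     least of order N. *)
  have -> : (n%:R - 2^-1) * d = d * n%:R - d / 2 by ring.
  rewrite (@powRB _ _ (d * n%:R) (d / 2)) ?(gt_eqF N1) ?implybT//.
  rewrite (powRrM _ d n%:R) powR_mulrn ?powR_ge0//.
  rewrite [leRHS]mulrCA ler_wpM2l ?exprn_ge0 ?powR_ge0//.
  rewrite -mulrA -invfM -powRM ?divr_ge0 ?(ltW lambda_gt0)//.
  rewrite (mulrAC lambda 2^-1) ler_pdivlMr// powR_gt0// divr_gt0// mulr_gt0//.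
have [c c0 hc] := mode_norm_cvg p_ge2.
rewrite -/d in hc.
have k00 : 0 < mode_norm p 1 0 := mode_norm0_gt0 p_ge2.
case: n n_gt0 => // n _.
(* Here n counts the zero components of mu, each contributing [mode_norm p 1 0]. The remaining
   component k contributes c k^(-d/2), and k ~ lambda N turns this into c lambda^(-d/2) N^(-d/2). *)
pose C' := c * mode_norm p 1 0 ^+ n / lambda `^ (d / 2).
have C'0 : 0 < C' by rewrite divr_gt0 ?mulr_gt0 ?exprn_gt0// powR_gt0.
exists C' => // k /(asymp_equiv_EFin _ lN0) hk.
have norm_mu : \forall N \near \oo, Lp_norm p (bargmann_e N
    [tuple if val j == 0%N then k N else 0%N | j < n.+1]) =
    (N%:R `^ (d * n.+1%:R) * mode_norm p 1 (k N) * mode_norm p 1 0 ^+ n)%:E.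
  near=> N.
  have N0 : (0 < N)%N by near: N; exact: nbhs_infty_gt.
  rewrite Lp_norm_bargmann_e//; congr (_%:E).
  under eq_bigr do rewrite mode_normE// tnth_mktuple.
  rewrite big_split/= prodr_const card_ord -/d big_ord_recl/=.
  rewrite prodr_const card_ord mulrA powRrM powR_mulrn ?powR_ge0//.
rewrite /asymp_equiv.
apply: (@cvg_trans _
  (((N%:R `^ (d * n.+1%:R) * mode_norm p 1 (k N) * mode_norm p 1 0 ^+ n)%:E /
    (C' * N%:R `^ ((n.+1%:R - 2^-1) * d))%:E)%E @[N --> \oo])).
  by apply: near_eq_cvg; near=> N; rewrite (near norm_mu N).
apply/asymp_equiv_EFin.
  near=> N; rewrite mulr_gt0// powR_gt0// ltr0n; near: N; exact: nbhs_infty_gt.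
have kinf : k N @[N --> \oo] --> \oo.
  apply/cvgnyPge => A; near=> N.
  rewrite -(ler_nat R); apply: (@le_trans _ _ (lambda * N%:R / 2)).
    rewrite ler_pdivlMr// -ler_pdivrMl//; near: N; exact: nbhs_infty_ger.
  by near: N; exact: asymp_linear_ge.
have hkc := cvg_comp _ _ kinf hc.
have hr : ((k N)%:R / (lambda * N%:R)) `^ (d / 2) @[N --> \oo] --> (1 : R).
  have one : 1 `^ (d / 2) = 1 :> R by rewrite powR1.
  rewrite -[X in _ --> X]one.
  exact: (@continuous_cvg _ _ _ _ _ _ (fun y : R => y `^ (d / 2)) _
    (@continuous_powR R _ _ ltr01) hk).
(* Once the powers of N and the constants are cancelled, the quotient to be studied is this product
   of two sequences tending to 1. *)
have cc : (mode_norm p 1 (k N) * (k N)%:R `^ (d / 2)) / c *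
    (((k N)%:R / (lambda * N%:R)) `^ (d / 2))^-1 @[N --> \oo] --> (1 : R).
  rewrite -[X in _ --> X]mulr1; apply: cvgM.
    rewrite -[X in _ --> X](divff (lt0r_neq0 c0)).
    exact: (cvgM hkc (cvg_cst c^-1)).
  by rewrite -[X in _ --> X]invr1; exact: (cvgV (oner_neq0 R) hr).
apply: cvg_trans cc; apply: near_eq_cvg; near=> N.
have N0 : (0 < N)%N by near: N; exact: nbhs_infty_gt.
have N1 : 0 < N%:R :> R by rewrite ltr0n.
have kN0 : 0 < (k N)%:R :> R.
  apply: (@lt_le_trans _ _ (lambda * N%:R / 2)); first by rewrite divr_gt0// mulr_gt0.
  by near: N; exact: asymp_linear_ge.
have -> : (n.+1%:R - 2^-1) * d = d * n.+1%:R - d / 2 by ring.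
rewrite (@powRB _ _ (d * n.+1%:R) (d / 2)) ?(gt_eqF N1) ?implybT// /C'.
rewrite (powRM (d / 2) (ltW kN0)) ?invr_ge0 ?mulr_ge0 ?(ltW lambda_gt0)//.
rewrite -[(lambda * N%:R)^-1]powR_inv1 ?mulr_ge0 ?(ltW lambda_gt0)// -powRrM mulN1r powRN.
rewrite powRM ?(ltW lambda_gt0)//.
have p1 := powR_gt0 (d / 2) kN0; have p2 := powR_gt0 (d / 2) N1.
have p3 := powR_gt0 (d / 2) lambda_gt0; have p4 := powR_gt0 (d * n.+1%:R) N1.
have p5 : 0 < mode_norm p 1 0 ^+ n by exact: exprn_gt0.
by field; rewrite !gt_eqF.
Unshelve. all: by end_near. Qed.
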